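(* For each of the following pairs $(p_0,C)$: $(10^{7},\,11.0421)$, $(10^{8},\,8.2760)$, $(10^{9},\,7.2906)$, $(10^{10},\,6.8121)$, $(10^{11},\,6.5496)$, $(10^{12},\,6.3964)$, $(10^{13},\,6.3033)$, $(10^{14},\,6.2452)$, $(10^{15},\,6.2077)$, $(10^{16},\,6.1829)$, $(10^{17},\,6.1659)$, $(10^{18},\,6.1536)$, $(10^{19},\,6.1445)$, $(10^{20},\,6.1374)$, the following holds: if $\chi$ is a non-principal Dirichlet character modulo a prime $p\geq p_0$ and $u$ is a prime with $u\geq e^2\log p$, then there exists a positive integer $n$ with $\gcd(n,u)=1$, $\chi(n)\neq 1$, and $$n<C\,p^{1/4}\log p.$$
   Context: $\log$ denotes the natural logarithm. A Dirichlet character modulo $p$ is non-principal if it is not the trivial character (the one equal to $1$ on all integers coprime to $p$). *)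

(* Defs.v *)
From mathcomp Require Import all_boot all_order all_algebra.
From mathcomp Require Import reals sequences exp complex.

Set Implicit Arguments.
Unset Strict Implicit.
Unset Printing Implicit Defensive.

Import Order.TTheory GRing.Theory Num.Theory.
Local Open Scope ring_scope.

Definition dirichlet_character (R : realType) (m : nat) (chi : int -> R[i]) :=
  [/\ forall a b : int, chi (a * b) = chi a * chi b,
      forall a : int, chi (a + m%:Z) = chi a
    & forall a : int, chi a != 0 <-> coprimez a m%:Z].

Definition principal (R : realType) (m : nat) (chi : int -> R[i]) :=
  forall a : int, coprimez a m%:Z -> chi a = 1.

(* decimal a d1 d2 d3 d4 is the number written a.d1d2d3d4 in base ten; the
   digits are kept apart because numerals of type R are unary. *)
Definition decimal (R : realType) (a d1 d2 d3 d4 : nat) : R :=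
  a%:R + d1%:R / 10 + d2%:R / 10 ^+ 2 + d3%:R / 10 ^+ 3 + d4%:R / 10 ^+ 4.

Definition constants (R : realType) : seq (R * R) :=
  [:: (10 ^+ 7,  decimal R 11 0 4 2 1);
      (10 ^+ 8,  decimal R 8 2 7 6 0);
      (10 ^+ 9,  decimal R 7 2 9 0 6);
      (10 ^+ 10, decimal R 6 8 1 2 1);
      (10 ^+ 11, decimal R 6 5 4 9 6);
      (10 ^+ 12, decimal R 6 3 9 6 4);
      (10 ^+ 13, decimal R 6 3 0 3 3);
      (10 ^+ 14, decimal R 6 2 4 5 2);
      (10 ^+ 15, decimal R 6 2 0 7 7);
      (10 ^+ 16, decimal R 6 1 8 2 9);
      (10 ^+ 17, decimal R 6 1 6 5 9);
      (10 ^+ 18, decimal R 6 1 5 3 6);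
      (10 ^+ 19, decimal R 6 1 4 4 5);
      (10 ^+ 20, decimal R 6 1 3 7 4)].

(* Main.v *)
Require Import Defs.
From mathcomp Require Import all_boot all_order all_algebra all_field.
From mathcomp Require Import zify ring lra.
From mathcomp Require Import cyclic.
From mathcomp Require Import reals sequences exp complex.

(* The kernel of chi is contained in the group of l-th powers modulo p, for some
   prime l dividing p - 1.  If chi(n) = 1 for all small n prime
   to u, then the integers following the fractions t p / q (q small, prime to u)
   are l-th powers, which produces many windows of h ~ log p consecutive l-th
   powers.  On the other hand, expanding the indicator of such windows in
   characters and using the Weil bound |sum_x chi(f(x))| <= (m - 1) sqrt p, there
   are at most h sqrt p of them once p <= 4^h.  This is enough to reach 6 in place
   of the constants C.  The Weil bound follows from the rationality of the
   L-function of the character (Euler product and Newton's identities) together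
   with a Bombieri-Stepanov estimate over the fields with p^(2n) elements. *)

Import Order.TTheory GRing.Theory Num.Theory.
Local Open Scope ring_scope.
Set Implicit Arguments.
Unset Strict Implicit.
Unset Printing Implicit Defensive.

(** * Frobenius orbits and irreducible polynomials over a prime field *)

(** The window length h cancels in the final comparison: each fraction supplies at least 2h + 1
    windows, against a total of at most h sqrt p. So only the number of fractions, of order X^2, is
    weighed against sqrt p; this forces X = O(p^(1/4)), while the integers tested go up to 4hX. A
    multiple of u may spoil one of the integers near a fraction; inspecting 4h of them leaves 2h + 1
    of the 3h + 1 possible starts intact.

    Stepanov's method is one-sided, works in extensions of even degree, and has a constant depending
    on l and on the degree of f. Lower bounds follow from upper ones because the classes of l-th
    power residues add up to almost the whole field. The constant disappears because the sums over
    all extensions are, up to sign, power sums of the same m - 1 or fewer numbers, so only the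
    growth rate matters. Distinctness of degrees in the auxiliary polynomial needs deg f prime to l;
    otherwise a root of f is sent to infinity. *)

Section MonicPolynomials.

Variable F : finFieldType.

Definition monics d : seq {poly F} :=
  [seq 'X^d + rVpoly v | v <- enum 'rV[F]_d].

Definition irrs d : seq {poly F} := [seq P <- monics d | irreducibleb P].

Lemma mem_monics d (g : {poly F}) :
  (g \in monics d) = (g \is monic) && (size g == d.+1).
Proof.
apply/mapP/andP=> [[v _ ->]|[g_monic /eqP sg]].
  have sv : (size (rVpoly v) < size ('X^d : {poly F}))%N.
    by rewrite size_polyXn ltnS size_poly.
  by rewrite monicE lead_coefDl // lead_coefXn size_polyDl // size_polyXn !eqxx.
exists (poly_rV (g - 'X^d)); first by rewrite mem_enum.
rewrite poly_rV_K; first by rewrite addrC subrK.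
apply/leq_sizeP=> j; rewrite leq_eqVlt coefB coefXn => /predU1P[<-|dj].
  by move/monicP: g_monic; rewrite /lead_coef sg /= eqxx => ->; rewrite subrr.
by rewrite nth_default ?sg // gtn_eqF // subr0.
Qed.

Lemma uniq_monics d : uniq (monics d).
Proof.
rewrite map_inj_uniq ?enum_uniq // => u v /addrI.
exact: (can_inj (@rVpolyK _ _)).
Qed.

Lemma mem_irrs d P :
  reflect [/\ irreducible_poly P, P \is monic & size P = d.+1] (P \in irrs d).
Proof.
rewrite mem_filter mem_monics.
apply: (iffP and3P) => [[/irreducibleP ? ? /eqP ?]|[? ? /eqP ?]] //.
by split=> //; apply/irreducibleP.
Qed.

Lemma uniq_irrs d : uniq (irrs d).
Proof. exact/filter_uniq/uniq_monics. Qed.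

End MonicPolynomials.

Section ConjugatesOverFiniteField.

Variables (F L : finFieldType) (iota : {rmorphism F -> L}) (n : nat).
Local Notation p := #|F|.
Hypothesis p_prime : prime p.
Hypothesis card_L : #|L| = (p ^ n)%N.

Definition frob (x : L) : L := x ^+ p.

Lemma pchar_ext : p \in [pchar L].
Proof. exact: (@card_finPcharP L p n). Qed.

Lemma frobB : {morph frob : x y / x - y}.
Proof. exact: (rmorphB (pFrobenius_aut pchar_ext)). Qed.

Lemma frob_inj : injective frob.
Proof. exact: (fmorph_inj (pFrobenius_aut pchar_ext)). Qed.

Lemma iter_frob i x : iter i frob x = x ^+ (p ^ i).
Proof.
by elim: i => [|i IHi] /=; rewrite ?expn0 ?expr1 // IHi /frob -exprM expnSr.
Qed.

Lemma frob_iota a : frob (iota a) = iota a.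
Proof. by rewrite /frob -rmorphXn expf_card. Qed.

(** [X^p - X] already has all of [F] as roots, so it has no root in [L] outside the image of
    [iota]. *)
Lemma frob_fixedP x : reflect (exists a, x = iota a) (frob x == x).
Proof.
apply: (iffP eqP) => [fx|[a ->]]; last exact: frob_iota.
have: root (map_poly iota ('X^p - 'X)) x.
  by rewrite rmorphB /= map_polyXn map_polyX rootE !hornerE /= -/(frob x) fx subrr.
rewrite finField_genPoly rmorph_prod /=.
under eq_bigr do rewrite rmorphB /= map_polyX map_polyC /=.
rewrite -(big_map iota xpredT (fun y => 'X - y%:P)) root_prod_XsubC.
by case/mapP=> a _ ->; exists a.
Qed.

Lemma order_frob_dvd x : (order frob x %| n)%N.
Proof.
have fxn : iter n frob x = x by rewrite iter_frob -card_L expf_card.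
have := iter_order frob_inj x; set d := order frob x => fxd.
have d_gt0 : (0 < d)%N by apply: order_gt0.
have iterd k : iter (k * d) frob x = x.
  by elim: k => // k IHk; rewrite mulSn iterD IHk.
have: iter (n %% d) frob x = x.
  by rewrite -[RHS]fxn {2}(divn_eq n d) addnC iterD iterd.
have ltd : (n %% d < d)%N by rewrite ltn_mod.
move=> fxm; rewrite /dvdn.
have /(uniqP x) inj_nth := orbit_uniq frob x.
apply/eqP/inj_nth; rewrite ?inE ?size_orbit //.
by rewrite /orbit !nth_traject.
Qed.

(** The minimal polynomial of [x] over [F], written in [L[X]] by its roots; the next lemmas justify
    this reading. *)
Definition conj_poly x : {poly L} := \prod_(y <- orbit frob x) ('X - y%:P).

(** Frobenius permutes the orbit, hence fixes every coefficient of the product, and its fixed points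
    come from [F]. *)
Lemma conj_poly_descends x : exists P : {poly F}, map_poly iota P = conj_poly x.
Proof.
have fixP : map_poly (pFrobenius_aut pchar_ext) (conj_poly x) = conj_poly x.
  rewrite /conj_poly rmorph_prod /=.
  under eq_bigr do rewrite rmorphB /= map_polyX map_polyC /=.
  rewrite -(big_map frob xpredT (fun y => 'X - y%:P)).
  apply: perm_big; apply: uniq_perm; rewrite ?orbit_uniq //.
    by rewrite (map_inj_uniq frob_inj) orbit_uniq.
  have fuU : uniq (map frob (orbit frob x)).
    by rewrite (map_inj_uniq frob_inj) orbit_uniq.
  have sub : {subset map frob (orbit frob x) <= orbit frob x}.
    by move=> _ /mapP[y xy ->]; apply: mem_orbit.
  by have [] := uniq_min_size fuU sub; rewrite ?size_map.
have exP i : {a | (conj_poly x)`_i = iota a}.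
  apply: sig_eqW; apply/frob_fixedP/eqP.
  by rewrite -[in RHS]fixP coef_map.
exists (\poly_(i < size (conj_poly x)) sval (exP i)).
apply/polyP=> i; rewrite coef_map coef_poly.
case: ltnP => [_|le_i]; first by case: (exP i) => a /= <-.
by rewrite [RHS]nth_default //; apply: raddf0.
Qed.

Lemma monic_conj_poly x : conj_poly x \is monic.
Proof. exact: monic_prod_XsubC. Qed.

Lemma size_conj_poly x : size (conj_poly x) = (order frob x).+1.
Proof. by rewrite size_prod_XsubC size_orbit. Qed.

Lemma root_conj_poly x y : root (conj_poly x) y = (y \in orbit frob x).
Proof. by rewrite root_prod_XsubC. Qed.

Lemma frob_horner (g : {poly F}) z :
  frob (map_poly iota g).[z] = (map_poly iota g).[frob z].
Proof.
rewrite -[LHS]/(pFrobenius_aut pchar_ext _) -horner_map /= -map_poly_comp.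
congr (_.[_]); apply/polyP=> j.
by rewrite !coef_map; apply: frob_iota.
Qed.

Lemma iter_frob_horner i (g : {poly F}) z :
  (map_poly iota g).[z] ^+ (p ^ i) = (map_poly iota g).[z ^+ (p ^ i)].
Proof. by rewrite -!iter_frob; elim: i => //= i ->; rewrite frob_horner. Qed.

Lemma conj_poly_dvd (g : {poly F}) x :
  root (map_poly iota g) x -> conj_poly x %| map_poly iota g.
Proof.
move=> gx; apply: uniq_roots_dvdp; last by rewrite uniq_rootsE orbit_uniq.
apply/allP=> y; rewrite -fconnect_orbit => /iter_findex <-.
elim: (findex _ _ _) => //= i; rewrite !rootE => /eqP gz.
set z := iter i frob x in gz *.
by rewrite -frob_horner gz /frob expr0n gtn_eqF ?prime_gt0.
Qed.

(** A nonconstant divisor over [F] has a root in the orbit, hence the whole orbit among its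
    roots. *)
Lemma conj_poly_irr (P : {poly F}) x :
  map_poly iota P = conj_poly x -> irreducible_poly P.
Proof.
move=> iP; split.
  by rewrite -(size_map_poly iota) iP size_conj_poly ltnS order_gt0.
move=> g sg gP.
have gP' : map_poly iota g %| conj_poly x by rewrite -iP dvdp_map.
have [m mE] := dvdp_prod_XsubC gP'.
have [y xy gy] : exists2 y, y \in orbit frob x & root (map_poly iota g) y.
  case E : (mask m (orbit frob x)) mE => [|y s] mE.
    move: sg; rewrite -(size_map_poly iota) (eqp_size mE) big_nil.
    by rewrite size_poly1.
  exists y; first by apply: (@mem_mask _ _ m); rewrite E mem_head.
  by rewrite (eqp_root mE) root_prod_XsubC mem_head.
have oyx : orbit frob y =i orbit frob x.
  move=> z; rewrite -!fconnect_orbit.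
  by rewrite (same_connect (fconnect_sym frob_inj) (_ : fconnect frob x y)) // fconnect_orbit.
have := conj_poly_dvd gy.
have -> : conj_poly y = conj_poly x.
  apply: perm_big; apply: uniq_perm; rewrite ?orbit_uniq //.
rewrite -iP dvdp_map => Pg; by rewrite /eqp gP Pg.
Qed.

(** A root z of [P] generates a field of p^(deg P) elements, so z^(p^n) = z and [P] divides X^(p^n)
    - X, which splits in [L]. *)
Lemma irr_has_root (P : {poly F}) :
    irreducible_poly P -> ((size P).-1 %| n)%N ->
  exists x, root (map_poly iota P) x.
Proof.
move=> irrP dvd_n.
have [E dimE [z Pz _]] := irredp_FAdjoin irrP.
have zq : z ^+ (p ^ n) = z.
  have zd : z ^+ (p ^ (size P).-1) = z.
    by have := Fermat's_little_theorem {:E}%AS z; rewrite memvf dimE => /esym/eqP.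
  have /dvdnP[k ->] := dvd_n.
  by elim: k => [|k IHk]; rewrite ?expn0 ?expr1 // mulSn expnD exprM zd IHk.
have dvdP : P %| 'X^(p ^ n) - 'X.
  have [cop|] := boolP (size (gcdp P ('X^(p ^ n) - 'X)) == 1).
    have: root (map_poly (in_alg E) (gcdp P ('X^(p ^ n) - 'X))) z.
      rewrite gcdp_map root_gcd Pz rmorphB /= map_polyXn map_polyX.
      by rewrite rootE !hornerE zq subrr.
    have g0 : gcdp P ('X^(p ^ n) - 'X) != 0 by rewrite -size_poly_eq0 (eqP cop).
    by move/root_size_gt1; rewrite map_poly_eq0 size_map_poly (eqP cop) => /(_ g0).
  move/irrP => /(_ (dvdp_gcdl _ _)) e; rewrite -(eqp_dvdl _ e).
  exact: dvdp_gcdr.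
have : map_poly iota P %| \prod_(x : L) ('X - x%:P).
  rewrite -finField_genPoly card_L -(map_polyXn iota) -(map_polyX iota) -rmorphB.
  by rewrite dvdp_map.
case/dvdp_prod_XsubC => m mE.
case E' : (mask m _) mE => [|y s] mE.
  have [+ _] := irrP; rewrite -(size_map_poly iota) (eqp_size mE) big_nil.
  by rewrite size_poly1.
by exists y; rewrite (eqp_root mE) root_prod_XsubC mem_head.
Qed.


(** Group the elements of [L] by minimal polynomial: each monic irreducible [P] of degree d dividing
    n occurs for exactly d elements. *)
Lemma sum_over_conjugates (V : zmodType) (G : L -> V) (H : {poly F} -> V) :
    (0 < n)%N ->
    (forall P x, map_poly iota P = conj_poly x -> G x = H P) ->
  \sum_x G x = \sum_(d <- divisors n) \sum_(P <- irrs F d) H P *+ d.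
Proof.
move=> n_gt0 GH.
have inj_iota := map_inj_poly (fmorph_inj iota) (rmorph0 iota).
transitivity (\sum_(d <- divisors n) \sum_(P <- irrs F d)
    \sum_(x | map_poly iota P == conj_poly x :> {poly L}) G x); last first.
  apply: eq_big_seq => d; rewrite -dvdn_divisors // => dn.
  apply: eq_big_seq => P /mem_irrs[irrP monP sP].
  have [x Px] : exists x, root (map_poly iota P) x.
    by apply: irr_has_root => //; rewrite sP.
  have PxE : map_poly iota P = conj_poly x.
    have [Q QE] := conj_poly_descends x.
    apply/eqP; rewrite -eqp_monic ?monic_map ?monic_conj_poly //.
    rewrite eqp_sym -QE eqp_map.
    apply: irrP; last by rewrite -(dvdp_map iota) QE conj_poly_dvd.
    by case: (conj_poly_irr QE) => sQ _; rewrite gtn_eqF.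
  rewrite (eq_bigr (fun _ => H P)) => [|y /eqP /GH //].
  rewrite sumr_const; congr (_ *+ _).
  have -> : d = order frob x.
    by apply: succn_inj; rewrite -size_conj_poly -PxE size_map_poly.
  rewrite -size_orbit -(card_uniqP (orbit_uniq frob x)); apply: eq_card => y.
  rewrite unfold_in PxE; apply/eqP/idP=> [/val_inj E|xy].
    by have := in_orbit frob y; rewrite -!root_conj_poly E.
  congr (\val _); apply: perm_big; apply: uniq_perm; rewrite ?orbit_uniq // => z.
  rewrite -!fconnect_orbit.
  by rewrite (same_connect (fconnect_sym frob_inj) (_ : fconnect frob x y)) // fconnect_orbit.
under [RHS]eq_bigr do rewrite (exchange_big_dep xpredT) //=.
rewrite (exchange_big_dep xpredT) //=; apply: eq_bigr => x _.
have [P PE] := conj_poly_descends x.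
have Pirr : P \in irrs F (order frob x).
  apply/mem_irrs; split; first exact: conj_poly_irr PE.
    by rewrite -(map_monic iota) PE monic_conj_poly.
  by rewrite -size_conj_poly -PE size_map_poly.
rewrite (bigD1_seq (order frob x)) ?divisors_uniq //=; last first.
  by rewrite -dvdn_divisors // order_frob_dvd.
rewrite big_mkcond (bigD1_seq P) ?uniq_irrs //= PE eqxx.
rewrite [X in _ + X + _]big1 => [|Q QP]; last first.
  by case: ifP => // e; move: e QP; rewrite -PE => /eqP/inj_iota ->; rewrite eqxx.
rewrite addr0.
rewrite big1_seq ?addr0 // => d /andP[dx _].
rewrite -big_filter big1_seq // => Q /andP[_].
rewrite mem_filter -PE => /andP[/eqP/inj_iota -> /mem_irrs[_ _ sP]].
by case/mem_irrs: Pirr dx => _ _; rewrite sP => -[->]; rewrite eqxx.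
Qed.

(** Both sides are the norm of c - x from [L] to [F]: the exponent on the right is 1 + p + ... +
    p^(n-1), and the n Frobenius iterates run n/d times through the orbit. *)
Lemma conj_poly_norm (P : {poly F}) x c : map_poly iota P = conj_poly x ->
  iota (P.[c] ^+ (n %/ order frob x)) = (iota c - x) ^+ (\sum_(i < n) p ^ i).
Proof.
move=> PE; set d := order frob x.
have hornerP : iota P.[c] = \prod_(i < d) (iota c - iter i frob x).
  rewrite -horner_map PE /conj_poly horner_prod (big_nth x) big_mkord size_orbit.
  apply: eq_bigr => i _; rewrite hornerXsubC /orbit nth_traject //.
have iterd k i : iter (k * d + i) frob x = iter i frob x.
  rewrite addnC iterD; congr iter; elim: k => // k IHk.
  by rewrite mulSn iterD IHk iter_order //; apply: frob_inj.
have iterB i : iter i frob (iota c - x) = iota c - iter i frob x.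
  by elim: i => //= i ->; rewrite frobB frob_iota.
rewrite -prodrXr; under eq_bigr do rewrite -iter_frob iterB.
have /dvdnP[k ->] := order_frob_dvd x; rewrite mulnK ?order_gt0 // rmorphXn hornerP.
rewrite -/d; elim: k => [|k IHk]; first by rewrite mul0n big_ord0 expr0.
rewrite mulSn addnC big_split_ord /= -IHk exprSr; congr (_ * _).
by apply: eq_bigr => i _; rewrite iterd.
Qed.

End ConjugatesOverFiniteField.

(** * The Euler product of a completely multiplicative function on F[X] *)

Section UniqueFactorization.

Variable F : finFieldType.

Lemma irreducible_divisor (g : {poly F}) :
  (1 < size g)%N -> exists2 P, irreducible_poly P & P %| g.
Proof.
have [m] := ubnP (size g); elim: m g => // m IHm g; rewrite ltnS => sgm sg.
have [irrg|] := boolP (irreducibleb g); first by exists g => //; apply/irreducibleP.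
rewrite /irreducibleb sg /= negb_forall => /existsP[q].
rewrite negb_imply -ltnNge -Pdiv.Idomain.dvdpE => /andP[qg sq].
have ltq : (size q < size g)%N by rewrite (leq_ltn_trans (size_npoly q)) // ltn_predL ltnW.
have [|//|P irrP Pq] := IHm q; first exact: leq_trans sgm.
by exists P => //; apply: dvdp_trans qg.
Qed.

Lemma monic_irreducible_divisor (g : {poly F}) : (1 < size g)%N ->
  exists P, [/\ irreducible_poly P, P \is monic & P %| g].
Proof.
case/irreducible_divisor=> P irrP Pg.
have lP0 : (lead_coef P)^-1 != 0 by rewrite invr_eq0 lead_coef_eq0 irredp_neq0.
exists ((lead_coef P)^-1 *: P); split; last by rewrite dvdpZl.
- split=> [|q sq]; first by rewrite size_scale //; case: irrP.
  by rewrite dvdpZr // => /irrP -/(_ sq) /eqp_trans; apply; rewrite eqp_sym eqp_scale.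
- by rewrite monicE lead_coefZ mulVf // lead_coef_eq0 irredp_neq0.
Qed.

Lemma irrs_coprime d1 d2 (P Q : {poly F}) :
  P \in irrs F d1 -> Q \in irrs F d2 -> P != Q -> coprimep P Q.
Proof.
move=> /mem_irrs[irrP monP _] /mem_irrs[irrQ monQ _].
apply: contraNT; rewrite /coprimep => sPQ.
have eP := irrP _ sPQ (dvdp_gcdl _ _); have eQ := irrQ _ sPQ (dvdp_gcdr _ _).
by rewrite -eqp_monic //; rewrite eqp_sym in eP; apply: eqp_trans eP eQ.
Qed.

(** The sum of v_P(g) deg P, where the valuation v_P(g) is counted as the number of k >= 1 with P^k
    dividing g, so that sums over g and over (P, k) can be exchanged. [N] only truncates. *)
Definition irr_degree N (g : {poly F}) : nat :=
  \sum_(1 <= d < N.+1) \sum_(P <- irrs F d) \sum_(1 <= k < N.+1) ((P ^+ k %| g)%R * d)%N.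

Lemma irr_degree_mul N d0 P0 (h : {poly F}) :
    P0 \in irrs F d0 -> h != 0 -> (size h <= N)%N -> (0 < d0 <= N)%N ->
  irr_degree N (P0 * h) = (irr_degree N h + d0)%N.
Proof.
move=> P0d h0 shN /andP[d0_gt0 d0N].
have [irrP0 monP0 sP0] := mem_irrs _ _ P0d.
pose S (g : {poly F}) d (P : {poly F}) := (\sum_(1 <= k < N.+1) ((P ^+ k %| g)%R * d)%N)%N.
pose e d (P : {poly F}) := if (P == P0)%R then d else 0%N.
have SE d P : P \in irrs F d ->
    S (P0 * h) d P = (S h d P + e d P)%N.
  move=> Pd; rewrite /S /e; case: eqVneq => [E|PP0]; last first.
    rewrite addn0; apply: eq_bigr => k _.
    by rewrite Gauss_dvdpr // coprimep_expl // (irrs_coprime Pd P0d).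
  have dv1 : P0 ^+ 1 %| P0 * h by rewrite expr1 dvdp_mulIl.
  rewrite E big_nat_recl; last by lia.
  rewrite dv1 mul1n addnC; congr (_ + _)%N.
  have [N' NE] : exists N', N = N'.+1 by exists N.-1; lia.
  rewrite NE [RHS]big_nat_recr //= -NE; apply: esym.
  (* Dividing by [P0] shifts k by one, so the last term k = N for [h] must be zero: deg P0^N >= N >
     deg h. *)
  have -> : (P0 ^+ N %| h) = false.
    apply/negbTE/negP=> /dvdp_leq -/(_ h0) le_s.
    move: (leq_pmull N d0_gt0) (size_exp P0 N) (leq_trans le_s shN).
    by rewrite sP0 /=; case: (size (P0 ^+ N)) => [|s] /=; lia.
  rewrite mul0n addn0.
  by apply: eq_bigr => k _; rewrite exprS dvdp_mul2l // irredp_neq0.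
rewrite /irr_degree.
have -> : (\sum_(1 <= d < N.+1) \sum_(P <- irrs F d) S (P0 * h)%R d P =
  \sum_(1 <= d < N.+1) \sum_(P <- irrs F d) S h d P +
  \sum_(1 <= d < N.+1) \sum_(P <- irrs F d) e d P)%N.
  rewrite -big_split; apply: eq_bigr => d _; rewrite -big_split.
  by apply: eq_big_seq => P /SE.
congr (_ + _)%N; rewrite (bigD1_seq d0) ?iota_uniq ?mem_index_iota ?ltnS ?d0_gt0 //=.
rewrite (bigD1_seq P0) ?uniq_irrs //= {1}/e eqxx big1 => [|P]; last by rewrite /e => /negPf ->.
rewrite addn0 big1 ?addn0 // => d dd0; rewrite big1_seq // => P /andP[_ Pd].
rewrite /e; case: eqP => // E; rewrite E in Pd; case/mem_irrs: Pd dd0 => _ _.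
by rewrite sP0 => -[->]; rewrite eqxx.
Qed.

Lemma irr_degreeE N n g : (n <= N)%N -> g \in monics F n -> irr_degree N g = n.
Proof.
elim/ltn_ind: n g => -[|n] IHn g nN; rewrite mem_monics => /andP[mong /eqP sg].
  have g1 : g = 1.
    have /size_poly1P[c _ gE] : size g == 1 by rewrite sg.
    by move/monicP: mong; rewrite gE lead_coefC => ->.
  apply: big1_seq => d _; apply: big1_seq => P /andP[_ /mem_irrs[irrP _ _]].
  apply: big1_seq => -[|k]; rewrite mem_index_iota //= => _.
  rewrite g1 (_ : _ %| _ = false) //; apply/negbTE/negP => P1.
  have: P %| 1 by apply: dvdp_trans P1; rewrite exprS dvdp_mulIl.
  by case: irrP => sP _; rewrite dvdp1 gtn_eqF.
have [|P [irrP monP /dvdpP[h gE]]] := @monic_irreducible_divisor g; first by rewrite sg.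
have monh : h \is monic by move: mong; rewrite gE monicMr.
have h0 := monic_neq0 monh; have P0 := monic_neq0 monP.
have [sP _] := irrP.
have := sg; rewrite gE size_mul // => sgE.
have sh : (0 < size h)%N by rewrite size_poly_gt0.
have Pd : P \in irrs F (size P).-1.
  by apply/mem_irrs; split=> //; rewrite prednK // ltnW.
move: sgE sP sh; set b := size P; set a := size h => sgE sP sh.
rewrite mulrC (irr_degree_mul Pd) //; [|by rewrite -/a; lia|by rewrite -/b; lia].
rewrite (IHn (size h).-1) ?mem_monics ?monh; [lia|lia|lia|].
by rewrite prednK // eqxx.
Qed.

End UniqueFactorization.

Section LSeries.

Variables (F : finFieldType) (C : comNzRingType) (Lam : {poly F} -> C).
Hypothesis LamM : {morph Lam : P Q / P * Q}.
Hypothesis Lam1 : Lam 1 = 1.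

(** Coefficient of T^n in L(T), the sum of Lam(g) T^(deg g) over monic g. *)
Definition lseries n : C := \sum_(g <- monics F n) Lam g.

(** Coefficient of T^n in T L'(T) / L(T), read off the Euler product. *)
Definition prime_powers n : C :=
  \sum_(d <- divisors n) \sum_(P <- irrs F d) Lam P ^+ (n %/ d) *+ d.

Lemma lseries_multiples e n (Q : {poly F}) : Q \is monic -> size Q = e.+1 ->
  \sum_(g <- monics F n | Q %| g) Lam g =
    if (e <= n)%N then Lam Q * lseries (n - e) else 0.
Proof.
move=> monQ sQ; have Q0 := monic_neq0 monQ.
case: leqP => [en|ne]; last first.
  rewrite big_seq_cond big_pred0 // => g; apply/negbTE/negP.
  rewrite mem_monics => /andP[/andP[mong /eqP sg]] /dvdp_leq.
  by rewrite sQ sg ltnS leqNgt ne => /(_ (monic_neq0 mong)).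
rewrite mulr_sumr -big_filter; under [RHS]eq_bigr do rewrite -LamM.
rewrite -[RHS](big_map _ xpredT Lam); apply: perm_big.
apply: uniq_perm.
- exact/filter_uniq/uniq_monics.
- by rewrite map_inj_uniq ?uniq_monics //; apply: mulfI.
move=> g; rewrite mem_filter mem_monics; apply/idP/mapP.
  case/and3P=> /dvdpP[h ->] mong /eqP sg; exists h; last by rewrite mulrC.
  have monh : h \is monic by move: mong; rewrite monicMr.
  rewrite mem_monics monh /=; move: sg; rewrite size_mul ?monic_neq0 // sQ.
  by rewrite addnS /= => sg; apply/eqP; rewrite -subSn // -sg addnK.
case=> h; rewrite mem_monics => /andP[monh /eqP sh] ->.
rewrite dvdp_mulIl monicMl // monh /= size_mul ?monic_neq0 // sQ sh.
by rewrite addSn /= addnS subnKC.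
Qed.

Lemma LamX P k : Lam (P ^+ k) = Lam P ^+ k.
Proof. by elim: k => [|k IHk]; rewrite ?expr0 // !exprS LamM IHk. Qed.

(* Logarithmic derivative of the Euler product, coefficient by coefficient:
   count the degree of each monic [g] along its prime power divisors. *)
Lemma lseries_rec n :
  lseries n *+ n = \sum_(1 <= j < n.+1) prime_powers j * lseries (n - j).
Proof.
pose X d k P := Lam P ^+ k * lseries (n - d * k).
transitivity (\sum_(1 <= d < n.+1) \sum_(P <- irrs F d) \sum_(1 <= k < n.+1)
   (if (d * k <= n)%N then X d k P *+ d else 0)).
  rewrite /lseries -sumrMnl.
  transitivity (\sum_(g <- monics F n) \sum_(1 <= d < n.+1) \sum_(P <- irrs F d)
     \sum_(1 <= k < n.+1) Lam g *+ ((P ^+ k %| g)%R * d)).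
    apply: eq_big_seq => g gn; rewrite -[in LHS](irr_degreeE (leqnn n) gn).
    rewrite /irr_degree -sumrMnr; apply: eq_bigr => d _.
    by rewrite -sumrMnr; apply: eq_bigr => P _; rewrite -sumrMnr.
  rewrite exchange_big; apply: eq_bigr => d _ /=.
  rewrite exchange_big; apply: eq_big_seq => P /mem_irrs[_ monP sP] /=.
  rewrite exchange_big; apply: eq_bigr => k _ /=.
  have monPk : P ^+ k \is monic by apply: rpredX.
  have sPk : size (P ^+ k) = (d * k).+1.
    have := size_exp P k; rewrite sP /= => <-.
    by rewrite prednK // size_poly_gt0 monic_neq0.
  have := lseries_multiples n monPk sPk; rewrite big_mkcond /= => E.
  transitivity ((\sum_(g <- monics F n) (if P ^+ k %| g then Lam g else 0)) *+ d).
    rewrite -sumrMnl; apply: eq_bigr => g _.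
    by case: (P ^+ k %| g); rewrite ?mul1n // mul0n mul0rn.
  by rewrite E LamX /X; case: leqP => // _; rewrite mul0rn.
under eq_bigr => d _ do rewrite exchange_big.
(* Group the pairs (d, k) by the degree j = d k of P^k. *)
transitivity (\sum_(1 <= j < n.+1) \sum_(1 <= d < n.+1) \sum_(1 <= k < n.+1)
  if (j == d * k)%N then \sum_(P <- irrs F d) X d k P *+ d else 0).
  rewrite [RHS]exchange_big; apply: eq_big_nat => d /andP[d_gt0 _] /=.
  rewrite [RHS]exchange_big; apply: eq_big_nat => k /andP[k_gt0 _] /=.
  rewrite -[RHS]big_mkcond /= big_nat1_eq.
  have -> : (1 <= d * k < n.+1)%N = (d * k <= n)%N.
    by rewrite muln_gt0 d_gt0 k_gt0 ltnS.
  by case: leqP => // _; rewrite big1.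
apply: eq_big_nat => j /andP[j_gt0 jn].
transitivity (\sum_(1 <= d < n.+1 | (d %| j)%N)
    \sum_(P <- irrs F d) X d (j %/ d)%N P *+ d).
  rewrite [RHS]big_mkcond; apply: eq_big_nat => d /andP[d_gt0 dn].
  rewrite -big_mkcond /=; case: ifP => [/dvdnP[k jE]|ndj]; last first.
    by rewrite big1 // => k /eqP E; rewrite E dvdn_mulr in ndj.
  rewrite {1}jE; under eq_bigl => k' do rewrite mulnC eqn_pmul2l // eq_sym.
  rewrite big_nat1_eq jE mulnK //.
  suff -> : (1 <= k < n.+1)%N by [].
  by rewrite ltnS; nia.
rewrite /prime_powers mulr_suml.
transitivity (\sum_(d <- divisors j) \sum_(P <- irrs F d) X d (j %/ d)%N P *+ d).
  rewrite -[LHS]big_filter; apply: perm_big; apply: uniq_perm;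
    rewrite ?filter_uniq ?iota_uniq ?divisors_uniq //.
  move=> d; rewrite mem_filter mem_index_iota -dvdn_divisors // ltnS.
  case dj: (d %| j)%N => //=; rewrite (dvdn_gt0 j_gt0 dj) /=.
  by rewrite (leq_trans (dvdn_leq j_gt0 dj)).
apply: eq_big_seq => d; rewrite -dvdn_divisors // => dj; rewrite mulr_suml.
apply: eq_bigr => P _; rewrite /X mulrnAl mulnC divnK //.
Qed.

End LSeries.

(** * The Bombieri-Stepanov bound *)

Section LinearDependence.

Variables (F : fieldType) (I : finType).

Lemma poly_dependence (v : I -> {poly F}) D :
    (forall i, (size (v i) <= D)%N) -> (D < #|I|)%N ->
  exists2 c : I -> F, (exists i, c i != 0) & \sum_i c i *: v i = 0.
Proof.
move=> sv ltD; pose M := \matrix_(i < #|I|, j < D) (v (enum_val i))`_j.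
have /rowV0Pn[u uM u0] : kermx M != 0.
  rewrite -mxrank_eq0 mxrank_ker -lt0n subn_gt0.
  exact: leq_ltn_trans (rank_leq_col M) ltD.
have {}uM : u *m M = 0 by apply/sub_kermxP.
exists (fun i => u 0 (enum_rank i)).
  have /rV0Pn[j uj] := u0.
  by exists (enum_val j); rewrite enum_valK.
apply/polyP=> j; rewrite coef_sum coef0.
have [jD|Dj] := ltnP j D; last first.
  by rewrite big1 // => i _; rewrite coefZ nth_default ?mulr0 // (leq_trans (sv i)).
have /rowP/(_ (Ordinal jD)) := uM; rewrite !mxE => E.
rewrite -[RHS]E (reindex_onto enum_val enum_rank) /=; last by move=> i _; rewrite enum_rankK.
by apply: eq_big => [i|i _]; rewrite ?enum_valK ?eqxx // coefZ mxE.
Qed.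

(** Among the terms with nonzero coefficient, the one of largest size has a leading term that
    nothing can cancel. *)
Lemma poly_independence (v : I -> {poly F}) (c : I -> F) :
    (forall i, v i != 0) -> injective (fun i => size (v i)) ->
  \sum_i c i *: v i = 0 -> forall i, c i = 0.
Proof.
move=> v0 inj_v sum0 i0; apply/eqP; apply: contraT => ci0.
case: (@arg_maxnP _ i0 (fun i => c i != 0) (fun i => size (v i)) ci0) => i ci maxi.
have := congr1 (fun h : {poly F} => h`_(size (v i)).-1) sum0.
rewrite coef_sum coef0 (bigD1 i) //= big1 ?addr0 => [|j ji]; last first.
  rewrite coefZ; have [->|cj] := eqVneq (c j) 0; first by rewrite mul0r.
  rewrite nth_default ?mulr0 // -ltnS prednK ?size_poly_gt0 //.
  have /= := maxi j cj; rewrite leq_eqVlt; case/predU1P=> [/inj_v e|//].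
  by rewrite e eqxx in ji.
rewrite coefZ => /eqP; rewrite mulf_eq0 (negPf ci) /=.
by rewrite -/(lead_coef (v i)) lead_coef_eq0 (negPf (v0 i)).
Qed.

End LinearDependence.

Section StepanovArithmetic.

Local Open Scope nat_scope.

(** With Q = l r + 1, A = r - d and B = r + d + 2, this is Q A + B + d Q < A B l: fewer linear
    conditions than coefficients. The terms l r^2 cancel and the surplus is 2 r (l - 1) minus a
    quantity independent of r. *)
Lemma stepanov_unknowns l d r : 1 < l -> d * d * l + 2 * d * l + 2 * d + 2 <= r ->
  (l * r).+1 * (r - d) + (r + d + 2) + d * (l * r).+1 < (r - d) * (r + d + 2) * l.
Proof.
move=> l_gt1 r_big; have [s rE] : exists s, r = s + d by exists (r - d); lia.
have s_big : d * d * l + 2 * d * l + d + 2 <= s by lia.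
have sl : s * 2 <= s * l by rewrite leq_mul2l l_gt1 orbT.
have dl : d * 2 <= d * l by rewrite leq_mul2l l_gt1 orbT.
have ddl : 0 <= d * d * l by [].
rewrite rE addnK; lia.
Qed.

(** This turns y^(Q (1 + b r)) into zeta^b y^(Q - b r) when y^(r (Q + 1)) = zeta. *)
Lemma stepanov_exponents Q B r : B * r <= Q ->
  Q * (1 + B * r) = r * Q.+1 * B + (Q - B * r).
Proof.
move=> le; have [t ->] : exists t, Q = B * r + t by exists (Q - B * r); rewrite subnKC.
by rewrite addKn; ring.
Qed.

(** Since l r = Q - 1, the dominant term l Q r is Q^2 - Q; everything else is linear in Q. *)
Lemma stepanov_degree l d r (Q := (l * r).+1) :
  l * ((r - d) + Q * (r + d + 2) + d * Q) <= Q * Q + (l * (2 * d + 2) + 1) * Q.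
Proof.
have : l * (r - d) <= l * r by rewrite leq_mul2l leq_subr orbT.
rewrite /Q; lia.
Qed.

End StepanovArithmetic.

Section Stepanov.

Variables (F L : finFieldType) (iota : {rmorphism F -> L}) (n : nat).
Local Notation p := #|F|.
Hypothesis p_prime : prime p.
Hypothesis card_L : #|L| = (p ^ (n + n))%N.
Local Notation Q := (p ^ n)%N.
Variables (l r d : nat) (f : {poly F}) (zeta : F).
Hypotheses (l_gt1 : (1 < l)%N) (QE : Q = (l * r).+1) (sf : size f = d.+1).
Hypothesis co_dl : coprime d l.
Hypothesis r_big : (d * d * l + 2 * d * l + 2 * d + 2 <= r)%N.

(* The auxiliary polynomial is K = sum c_{abg} X^(g + Q a) f^eps(b).  At points
   of F_{Q^2} where f^((Q^2-1)/l) = zeta, the value K(x)^Q = K(x^Q) is that of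
   sum c_{abg} zeta^b X^(Q g + a) f^del(b), whose degree is so much smaller
   that the c_{abg} can be chosen to make it vanish identically.  Then
   K <> 0 because its summands have distinct degrees: this is where
   gcd (deg f, l) = 1 is used. *)
Lemma stepanov_bound :
  (l * #|[set x : L | (map_poly iota f).[x] ^+ (r * Q.+1) == iota zeta]|
     <= Q * Q + (l * (2 * d + 2) + 1) * Q)%N.
Proof.
have f0 : f != 0 by rewrite -size_poly_eq0 sf.
pose A := (r - d)%N; pose B := (r + d + 2)%N.
have rd : (d <= r)%N by lia.
pose I : finType := ('I_A * 'I_B * 'I_l)%type.
(* For b > 0 the exponent 1 + b r, rather than b r, makes the reduced exponent [del] equal to Q - b
   r, which is nonnegative; for b = 0 both exponents can be 0. *)
pose eps (b : nat) := if b is 0 then 0%N else (1 + b * r)%N.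
pose del (b : nat) := if b is 0 then 0%N else (Q - b * r)%N.
pose v (i : I) : {poly F} := zeta ^+ i.2 *: ('X^(Q * i.1.1 + i.1.2) * f ^+ del i.2).
pose w (i : I) : {poly F} := 'X^(i.1.1 + Q * i.1.2) * f ^+ eps i.2.
have sfX k : size (f ^+ k) = (d * k).+1.
  have := size_exp f k; rewrite sf /= => <-.
  by rewrite prednK // size_poly_gt0 expf_neq0.
have sXf a k : size ('X^a * f ^+ k) = (a + d * k).+1.
  by rewrite size_monicM ?monicXn ?expf_neq0 // size_polyXn sfX addSn addnS.
have sv i : (size (v i) <= Q * A + B + d * Q)%N.
  rewrite (leq_trans (size_scale_leq _ _)) // sXf.
  have dQ : (d * del i.2 <= d * Q)%N.
    by rewrite leq_mul // /del; case: (nat_of_ord i.2) => // b; apply: leq_subr.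
  have QA : (Q * i.1.1 <= Q * A)%N by rewrite leq_mul // ltnW.
  have := ltn_ord i.1.2; lia.
have cardI : #|I| = (A * B * l)%N by rewrite !card_prod !card_ord.
have [||c [i1 ci1] sum_v] := @poly_dependence F I v (Q * A + B + d * Q).
- by [].
- by rewrite cardI /A /B QE; apply: stepanov_unknowns.
have inj_w : injective (fun i => size (w i)).
  (* Multiply the degree of [w i] by l and use l r = Q - 1: in base Q the result is [M i * Q + o i]
     with [o i < Q] (this is where A = r - d enters). So the degree determines [M i] and [o i], and
     [M i] modulo l determines b because d is prime to l. *)
  pose lead (b : nat) := if b is 0 then 0%N else (l - b)%N.
  pose M (i : I) := (l * i.1.2 + d * i.2)%N.
  pose o (i : I) := (l * i.1.1 + d * lead i.2)%N.
  have oQ i : (o i < Q)%N.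
    have ld : (d * lead i.2 <= d * l)%N.
      by rewrite leq_mul // /lead; case: (nat_of_ord i.2) => // b; apply: leq_subr.
    have := ltn_ord i.1.1; rewrite /o QE ltnS /A; move: (nat_of_ord i.1.1) => a lt_a.
    have ad : (a + d <= r)%N by lia.
    have : (l * (a + d) <= l * r)%N by rewrite leq_mul.
    by apply: leq_trans; rewrite mulnDr leq_add2l [(l * d)%N]mulnC.
  have szE i : (l * (size (w i)).-1)%N = (M i * Q + o i)%N.
    rewrite sXf /M /o /eps /lead QE; have := ltn_ord i.2.
    move: (nat_of_ord i.1.1) (nat_of_ord i.1.2) => a b'.
    case: (nat_of_ord i.2) => [|b] bl; first by rewrite /=; ring.
    have [e lE] : exists e, l = (b.+1 + e)%N by exists (l - b.+1)%N; lia.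
    by rewrite lE addKn /=; ring.
  move=> i j /= sij; have := szE i; rewrite sij szE => E.
  have ME : M j = M i.
    have := congr1 (divn^~ Q) E.
    by rewrite /= !divnMDl ?expn_gt0 ?prime_gt0 // !divn_small // !addn0.
  have oE : o i = o j by move: E; rewrite ME => /addnI.
  have key b b' x y : (y < l)%N -> (x <= y)%N ->
      (l * b + d * x = l * b' + d * y)%N -> x = y.
    move=> yl xy bxy; have : (l %| d * (y - x))%N.
      rewrite mulnBr (_ : (d * y - d * x = l * b - l * b')%N); last by lia.
      by rewrite -mulnBr dvdn_mulr.
    rewrite Gauss_dvdr 1?coprime_sym // => /dvdn_leq; lia.
  have e3 : i.2 = j.2 :> nat.
    have := ltn_ord i.2; have := ltn_ord j.2; case: (leqP i.2 j.2) => [ij jl _|/ltnW ji _ il].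
      by apply: key jl ij (esym ME).
    by apply/esym; apply: key il ji ME.
  have e2 : i.1.2 = j.1.2 :> nat.
    by move: ME; rewrite /M e3 => /addIn/eqP; rewrite eqn_pmul2l 1?ltnW // => /eqP.
  have e1 : i.1.1 = j.1.1 :> nat.
    by move: oE; rewrite /o e3 => /addIn/eqP; rewrite eqn_pmul2l 1?ltnW // => /eqP.
  move: i j e1 e2 e3 {sij E ME oE} => [[i1' i2] i3] [[j1 j2] j3] /=.
  by do 3!move=> /val_inj ->.
have w0 i : w i != 0 by rewrite -size_poly_eq0 /w sXf.
pose K := \sum_i c i *: w i.
have K0 : K != 0.
  by apply: contraNneq ci1 => K0; rewrite (poly_independence w0 inj_w K0).
have sK : (size K <= A + Q * B + d * Q)%N.
  apply: (leq_trans (size_sum _ _ _)); apply/bigmax_leqP => i _.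
  rewrite (leq_trans (size_scale_leq _ _)) // sXf.
  have dQ : (d * eps i.2 <= d * Q)%N.
    rewrite leq_mul // /eps; have := ltn_ord i.2.
    by case: (nat_of_ord i.2) => // b bl; rewrite QE add1n ltnS leq_mul2r ltnW ?orbT.
  have QB : (Q * i.1.2 <= Q * B)%N by rewrite leq_mul // ltnW.
  have := ltn_ord i.1.1; lia.
have rootK x : (map_poly iota f).[x] ^+ (r * Q.+1) == iota zeta ->
    root (map_poly iota K) x.
  move=> /eqP fx.
  suff: (map_poly iota K).[x] ^+ Q == 0 by rewrite expf_eq0 => /andP[].
  have Kx : (map_poly iota K).[x] ^+ Q = (map_poly iota K).[x ^+ Q].
    exact: iter_frob_horner p_prime card_L _ _ _.
  have <- : (map_poly iota (\sum_i c i *: v i)).[x] = 0.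
    by rewrite sum_v rmorph0 horner0.
  apply/eqP; rewrite Kx !rmorph_sum !horner_sum; apply: eq_bigr => i _.
  rewrite /= !map_polyZ !rmorphM /= !map_polyXn !rmorphXn !hornerE /=.
  rewrite -(iter_frob_horner iota p_prime card_L).
  set y := (map_poly iota f).[x] in fx *.
  (* As x^(Q^2) = x, raising to the power Q exchanges the two digits of the exponent. *)
  have xE : (x ^+ Q) ^+ (i.1.1 + Q * i.1.2) = x ^+ (Q * i.1.1 + i.1.2).
    have xQQ : x ^+ (Q * Q) = x by rewrite -expnD -card_L expf_card.
    by rewrite !exprD -!exprM mulnA [x ^+ (Q * Q * _)]exprM xQQ.
  have yE : (y ^+ Q) ^+ eps i.2 = iota zeta ^+ i.2 * y ^+ del i.2.
    rewrite -fx -!exprM -exprD; congr (_ ^+ _).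
    rewrite /eps /del; have := ltn_ord i.2.
    case: (nat_of_ord i.2) => [|b] bl; first by rewrite !muln0.
    by apply: stepanov_exponents; rewrite QE leqW // leq_mul2r ltnW ?orbT.
  by rewrite xE yE; ring.
have : (#|[set x : L | (map_poly iota f).[x] ^+ (r * Q.+1) == iota zeta]| < size K)%N.
  rewrite -(size_map_poly iota) cardE; apply: max_poly_roots.
  - by rewrite map_poly_eq0.
  - by apply/allP=> x; rewrite mem_enum inE; apply: rootK.
  - exact: enum_uniq.
move=> /leq_trans/(_ sK); set N := #|_|.
rewrite /A /B QE => leN.
have : (l * N <= l * ((r - d) + (l * r).+1 * (r + d + 2) + d * (l * r).+1))%N.
  by rewrite leq_mul2l (ltnW leN) orbT.
by move=> /leq_trans; apply; apply: stepanov_degree.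
Qed.
End Stepanov.

(** * Newton's identities and growth of power sums *)

Section NewtonIdentities.

Variable C : comNzRingType.

(** With G the power sum series truncated at order n, X L' + G L vanishes modulo X^(n+1); this is
    proved by adding one factor at a time, then read at degree n. *)
Lemma newton_identities (s : seq C) n :
  let L := \prod_(w <- s) (1 - w *: 'X) in
  L`_n *+ n = - \sum_(1 <= j < n.+1) (\sum_(w <- s) w ^+ j) * L`_(n - j).
Proof.
pose G (s : seq C) := \sum_(1 <= j < n.+1) (\sum_(w <- s) w ^+ j) *: 'X^j : {poly C}.
pose Lp (s : seq C) := \prod_(w <- s) (1 - w *: 'X) : {poly C}.
have deriv1 : (1 : {poly C})^`() = 0 by rewrite -polyC1 derivC.
have [h hE] : exists h : {poly C},
    'X * (Lp s)^`() + G s * Lp s = 'X^(n.+1) * h.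
  elim: s => [|w s [h IHs]].
    exists 0; rewrite /Lp big_nil deriv1 /G big1 ?mul0r ?mulr0 ?addr0 // => j _.
    by rewrite big_nil scale0r.
  have GE : (1 - w *: 'X) * G (w :: s) =
      (1 - w *: 'X) * G s + w *: 'X - w ^+ n.+1 *: 'X^(n.+1).
    rewrite -addrA /G; under eq_bigr do rewrite big_cons scalerDl.
    rewrite big_split /= mulrDr addrC; congr (_ + _).
    elim: (n) => [|k IHk]; first by rewrite big_geq // mulr0 !expr1 subrr.
    rewrite big_nat_recr //= mulrDr IHk mulrBl mul1r -scalerAl -scalerAr.
    by rewrite scalerA -exprS -exprS addrA subrK.
  exists ((1 - w *: 'X) * h - w ^+ n.+1 *: Lp s).
  rewrite mulrBr mulrCA -IHs /Lp big_cons -/(Lp s) derivM derivB derivZ derivX.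
  rewrite deriv1 sub0r mulrCA mulrA [G _ * _]mulrC GE.
  rewrite -!mul_polyC !rmorphXn /=; ring.
have := congr1 (fun g : {poly C} => g`_n) hE.
rewrite coefXnM ltnSn coefD coefXM -/(Lp s) => E; move: E.
have -> : (if n == 0%N then 0 else (Lp s)^`()`_n.-1) = (Lp s)`_n *+ n.
  by case: (n) => [|k] //=; rewrite coef_deriv.
rewrite /= -/(Lp s); move/eqP; rewrite addr_eq0 => /eqP -> ; congr (- _).
rewrite /G mulr_suml coef_sum; apply: eq_big_nat => j /andP[_ jn].
by rewrite -scalerAl coefZ coefXnM ltnNge -ltnS jn /=.
Qed.

End NewtonIdentities.

Section PowerSums.

Local Notation C := algC.

(** The [A n] are the coefficients of a polynomial with constant term 1, a product of factors 1 - w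
    X. Newton's identities give the same recurrence for the negated power sums, and [A 0 = 1] lets
    it be solved for [T n]. *)
Lemma power_sums_of_rec (A T : nat -> C) M :
    A 0%N = 1 -> (forall n, (M < n)%N -> A n = 0) ->
    (forall n, A n *+ n = \sum_(1 <= j < n.+1) T j * A (n - j)%N) ->
  exists2 s : seq C, (size s <= M)%N &
    forall n, (0 < n)%N -> T n = - \sum_(w <- s) w ^+ n.
Proof.
move=> A0 A_big recA.
pose P := \poly_(i < M.+1) A i.
have coefP i : P`_i = A i by rewrite coef_poly; case: ltnP => // /A_big ->.
have P0 : P.[0] = 1 by rewrite horner_coef0 coefP.
have nzP : P != 0 by apply: contra_eq_neq P0 => ->; rewrite horner0 eq_sym oner_neq0.
have [r rE] := closed_field_poly_normal P.
have r0 z : z \in r -> z != 0.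
  move=> zr; apply: contra_eq_neq P0 => z0; rewrite -z0 (_ : P.[z] = 0).
    by rewrite eq_sym oner_neq0.
  apply/eqP; rewrite -rootE rE rootZ ?lead_coef_eq0 // root_prod_XsubC //.
have PE : P = \prod_(w <- map GRing.inv r) (1 - w *: 'X).
  rewrite big_map.
  have E : P = (lead_coef P * \prod_(z <- r) (- z)) *: \prod_(z <- r) (1 - z^-1 *: 'X).
    rewrite {1}rE -scalerA; congr (_ *: _).
    rewrite -scaler_prod; apply: eq_big_seq => z /r0 z0.
    rewrite scalerBr scalerA mulNr mulfV // scaleN1r opprK scaleNr addrC.
    by rewrite -alg_polyC.
  rewrite {1}E (_ : _ * _ = 1) ?scale1r //.
  have e : (\prod_(z <- r) (1 - z^-1 *: 'X)).[0] = 1.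
    rewrite horner_prod big1 // => z _.
    by rewrite hornerD hornerN hornerZ hornerX hornerC mulr0 subr0.
  by rewrite -[RHS]P0 {2}E hornerZ e mulr1.
exists (map GRing.inv r).
  rewrite size_map -ltnS; have := size_poly M.+1 A; rewrite -/P rE.
  by rewrite size_scale ?lead_coef_eq0 // size_prod_XsubC.
elim/ltn_ind=> n IHn n_gt0.
have := newton_identities (map GRing.inv r) n; rewrite /= -PE coefP recA.
rewrite big_nat_recr //= [X in _ = - X]big_nat_recr //= subnn coefP A0 !mulr1 opprD.
rewrite -sumrN => E; apply: (addrI _ (etrans E _)) => {E}; congr (_ + _).
apply: eq_big_nat => j /andP[j0 jn]; rewrite coefP.
by rewrite (IHn j) // mulNr.
Qed.

Lemma bernoulli_ineq (x : C) n : 0 <= x -> 1 + x *+ n <= (1 + x) ^+ n.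
Proof.
move=> x0; elim: n => [|n IHn]; first by rewrite mulr0n addr0.
rewrite exprS (le_trans _ (ler_wpM2l _ IHn)) ?addr_ge0 //.
rewrite mulrS -subr_ge0; set y := x *+ n.
have -> : (1 + x) * (1 + y) - (1 + (x + y)) = x * y by ring.
by rewrite mulr_ge0 // mulrn_wge0.
Qed.

Lemma geometric_growth (x rho K : C) n0 : 0 < rho -> 0 <= x ->
  (forall n, (n0 <= n)%N -> x ^+ n <= K * rho ^+ n) -> x <= rho.
Proof.
move=> rho0 x0 bound; rewrite real_leNgt ?ger0_real ?(ltW rho0) //; apply/negP=> rx.
pose y := x / rho - 1.
have y0 : 0 < y by rewrite subr_gt0 ltr_pdivlMr ?mul1r.
have xE : x = (1 + y) * rho by rewrite addrC subrK divfK ?gt_eqF.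
have K_bound n : (n0 <= n)%N -> 1 + y *+ n <= K.
  move=> /bound; rewrite {1}xE exprMn ler_pM2r ?exprn_gt0 //.
  by apply: le_trans; apply/bernoulli_ineq/ltW.
have K0 : 0 <= K by apply: le_trans (K_bound n0 _); rewrite ?addr_ge0 ?mulrn_wge0 ?ltW.
have := archi_boundP (divr_ge0 K0 (ltW y0)); set N := Num.bound _ => NK.
have := K_bound (n0 + N)%N (leq_addr _ _).
rewrite ltr_pdivrMr // mulrC mulr_natr in NK.
move=> leK; suff: y *+ N < y *+ N by rewrite ltxx.
apply: le_lt_trans NK; apply: le_trans leK; rewrite mulrnDr addrA lerDr.
by rewrite addr_ge0 // mulrn_wge0 // ltW.
Qed.

(** A polynomial g vanishing at the other members of [s] isolates w: combining the power sums of
    orders n + k with the coefficients of g leaves a nonzero multiple of w^n, which must be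
    O(rho^n). *)
Lemma power_sums_growth (s : seq C) (rho K : C) n0 : 0 < rho ->
    (forall n, (n0 <= n)%N -> `|\sum_(w <- s) w ^+ n| <= K * rho ^+ n) ->
  forall w, w \in s -> `|w| <= rho.
Proof.
move=> rho0 bound w ws.
pose g := \prod_(v <- rem w (undup s)) ('X - v%:P).
have gE n : \sum_(k < size g) g`_k * \sum_(v <- s) v ^+ (n + k) =
    (w ^+ n * g.[w]) *+ count_mem w s.
  under eq_bigr do rewrite mulr_sumr.
  rewrite exchange_big /= (bigID (pred1 w)) /= [X in _ + X]big1_seq ?addr0.
    rewrite -iter_addr_0 -big_const_seq; apply: eq_bigr => v /eqP ->.
    rewrite horner_coef mulr_sumr; apply: eq_bigr => k _.
    by rewrite mulrCA exprD.
  move=> v /andP[vw vs]; transitivity (v ^+ n * g.[v]).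
    rewrite horner_coef mulr_sumr; apply: eq_bigr => k _.
    by rewrite mulrCA exprD.
  suff /eqP -> : root g v by rewrite mulr0.
  by rewrite root_prod_XsubC mem_rem_uniq ?undup_uniq // inE vw mem_undup.
have gw : g.[w] != 0.
  rewrite -rootE root_prod_XsubC mem_rem_uniq ?undup_uniq // inE eqxx //.
pose K' := (\sum_(k < size g) `|g`_k| * K * rho ^+ k) / `|g.[w]|.
apply: (@geometric_growth _ _ K' n0) => // n nn0.
rewrite -mulrAC ler_pdivlMr ?normr_gt0 // -normrX -normrM.
apply: le_trans (_ : `|(w ^+ n * g.[w]) *+ count_mem w s| <= _).
  have : (0 < count_mem w s)%N by rewrite -has_count has_pred1.
  by rewrite normrMn; case: count => // k _; rewrite mulrS lerDl mulrn_wge0.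
rewrite -gE mulr_suml (le_trans (ler_norm_sum _ _ _)) //.
apply: ler_sum => k _; rewrite normrM -!mulrA ler_wpM2l //.
by rewrite -exprD addnC bound // (leq_trans nn0) // leq_addl.
Qed.

(* Since T n = - sum w^n over finitely many w, bounds on T (2n) for large n force
   |w|^2 <= rho for each w, which removes the constant K at n = 1. *)
Lemma power_trick (A T : nat -> C) M (rho K : C) n0 :
    A 0%N = 1 -> (forall n, (M < n)%N -> A n = 0) ->
    (forall n, A n *+ n = \sum_(1 <= j < n.+1) T j * A (n - j)%N) ->
    0 < rho -> (forall n, (n0 <= n)%N -> `|T (n + n)%N| <= K * rho ^+ n) ->
  `|T 1%N| <= M%:R * sqrtC rho.
Proof.
move=> A0 A_big recA rho0 bound.
have [s sM TE] := power_sums_of_rec A0 A_big recA.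
have s_bound w : w \in s -> `|w| <= sqrtC rho.
  move=> ws; rewrite -(@ler_pXn2r _ 2) ?nnegrE ?sqrtC_ge0 ?(ltW rho0) // sqrtCK -normrX.
  apply: (@power_sums_growth [seq w ^+ 2 | w <- s] rho K n0.+1) => //; last first.
    by apply/mapP; exists w.
  move=> n n0n; rewrite big_map.
  under eq_bigr do rewrite -exprM mul2n -addnn.
  by rewrite -normrN -TE ?bound ?(ltnW n0n) // addn_gt0 (leq_ltn_trans _ n0n).
rewrite TE // normrN (le_trans (ler_norm_sum _ _ _)) //.
rewrite (@le_trans _ _ (\sum_(w <- s) sqrtC rho)) //.
  by rewrite !big_seq; apply: ler_sum => w ws; rewrite expr1 s_bound.
rewrite big_const_seq count_predT iter_addr_0 mulr_natl.
by apply: ler_wpMn2l sM; rewrite sqrtC_ge0 ltW.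
Qed.

End PowerSums.

(** * The Weil bound *)

Section WeilBound.

Local Notation C := algC.
Variables (F : finFieldType) (l : nat) (chi : F -> C).
Local Notation p := #|F|.
Local Notation e := (p.-1 %/ l)%N.
Hypothesis p_prime : prime p.
Hypothesis extensions : forall n, (0 < n)%N ->
  exists (L : finFieldType) (iota : {rmorphism F -> L}), #|L| = (p ^ n)%N.
Hypotheses (l_prime : prime l) (l_dvd : (l %| p.-1)%N).
Hypothesis chiM : {morph chi : x y / x * y}.
Hypothesis chi0 : chi 0 = 0.
Hypothesis chi_eq1 : forall v, (chi v == 1) = (v != 0) && (v ^+ e == 1).

Lemma chi1 : chi 1 = 1.
Proof. by apply/eqP; rewrite chi_eq1 oner_neq0 expr1n eqxx. Qed.

Lemma chiX v k : chi (v ^+ k) = chi v ^+ k.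
Proof. by elim: k => [|k IHk]; rewrite ?expr0 ?chi1 // !exprS chiM IHk. Qed.

Lemma chi_prod (I : finType) (P : pred I) (G : I -> F) :
  chi (\prod_(i | P i) G i) = \prod_(i | P i) chi (G i).
Proof. exact: (big_morph chi chiM chi1). Qed.

Lemma expf_pred (v : F) : v != 0 -> v ^+ p.-1 = 1.
Proof.
move=> v0; apply: (mulfI v0).
by rewrite mulr1 -exprS prednK ?prime_gt0 // expf_card.
Qed.

Lemma chiXl v : v != 0 -> chi v ^+ l = 1.
Proof.
move=> v0; apply/eqP; rewrite -chiX chi_eq1 expf_neq0 //= -exprM.
by rewrite mulnC divnK // expf_pred.
Qed.

Lemma chi_neq0 v : v != 0 -> chi v != 0.
Proof.
move=> /chiXl; apply: contra_eq_neq => ->.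
by rewrite expr0n gtn_eqF ?prime_gt0 // eq_sym oner_neq0.
Qed.

Lemma norm_chi v : v != 0 -> `|chi v| = 1.
Proof.
move=> /chiXl vl; apply/eqP; rewrite -(@pexpr_eq1 _ _ l) ?prime_gt0 //.
by rewrite -normrX vl normr1.
Qed.

Lemma e_gt0 : (0 < e)%N.
Proof. by rewrite divn_gt0 ?prime_gt0 // dvdn_leq // -ltnS prednK ?prime_gt1 ?prime_gt0. Qed.

(** X^e - 1 has at most e < p - 1 roots, so some nonzero v has chi(v) different from 1; its order
    divides the prime l. *)
Lemma chi_primitive : exists2 v, v != 0 & l.-primitive_root (chi v).
Proof.
have [v v0 ve] : exists2 v : F, v != 0 & v ^+ e != 1.
  apply/exists_inP; apply: contraT; rewrite negb_exists => /forallP all1.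
  have: (#|[set v : F | (v != 0)%R]| < size ('X^e - 1 : {poly F})%R)%N.
    rewrite cardE; apply: max_poly_roots; last exact: enum_uniq.
      by rewrite -size_poly_eq0 size_XnsubC ?e_gt0.
    apply/allP=> v; rewrite mem_enum inE => v_neq0; rewrite rootE !hornerE subr_eq0.
    by have := all1 v; rewrite v_neq0 negbK.
  rewrite size_XnsubC ?e_gt0 // ltnS.
  have -> : #|[set v : F | (v != 0)%R]| = p.-1 by rewrite -(cardC1 (0 : F)) cardsE.
  by rewrite leqNgt ltn_Pdiv ?prime_gt1 // -ltnS prednK ?prime_gt1 ?prime_gt0.
exists v => //; have [m prim_m] := prim_order_exists (prime_gt0 l_prime) (chiXl v0).
case/primeP: l_prime => _ dvd_l /dvd_l /orP[]/eqP mE; last by rewrite -mE.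
have := prim_expr_order prim_m; rewrite mE expr1 => /eqP.
by rewrite chi_eq1 v0 (negPf ve).
Qed.

Variables (m : nat) (c : 'I_m -> F) (a : 'I_m -> nat).
Hypotheses (m_gt0 : (0 < m)%N) (inj_c : injective c).
Hypothesis co_al : forall i, coprime (a i) l.
Hypothesis co_dl : coprime (\sum_i a i) l.

(** At X - x this is chi of [weil_poly] at x, so the coefficient of degree one of the L-series is
    the sum to be bounded. *)
Definition twist (g : {poly F}) : C := chi (\prod_i g.[c i] ^+ a i).

Lemma twistM : {morph twist : g h / g * h}.
Proof.
move=> g h; rewrite /twist -chiM -big_split; congr chi; apply: eq_bigr => i _.
by rewrite hornerM exprMn.
Qed.

Lemma twist1 : twist 1 = 1.
Proof. by rewrite /twist big1 ?chi1 // => i _; rewrite hornerC expr1n. Qed.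

Lemma sum_chiX k : coprime k l -> \sum_x chi (x ^+ k) = 0.
Proof.
move=> co_kl; have [v v0 prim_v] := chi_primitive.
have vk1 : chi (v ^+ k) != 1.
  rewrite chiX -(prim_order_dvd prim_v); apply: contraL co_kl => /gcdn_idPl E.
  by rewrite /coprime gcdnC E gtn_eqF ?prime_gt1.
apply: (mulfI (_ : chi (v ^+ k) - 1 != 0)); first by rewrite subr_eq0.
rewrite mulr0 mulrBl mul1r [X in _ - X](reindex_inj (mulfI v0)) mulr_sumr -sumrB.
by rewrite big1 // => x _; rewrite exprMn chiM subrr.
Qed.

(** In degree n >= m, adding multiples of a polynomial of degree m - 1 that vanishes at every c_i
    but one lets a single value of g run through [F] while the others stay fixed; the sum of
    chi(y^a) over y is zero. *)
Lemma lseries_twist0 n : (m.-1 < n)%N -> lseries twist n = 0.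
Proof.
move=> mn; pose i0 := Ordinal m_gt0.
pose h := \prod_(i | i != i0) ('X - (c i)%:P).
have hc i : i != i0 -> h.[c i] = 0.
  move=> ii0; apply/eqP; rewrite -rootE /h -big_filter.
  rewrite -(big_map c xpredT (fun y => 'X - y%:P)) root_prod_XsubC.
  by apply/mapP; exists i; rewrite // mem_filter ii0 mem_index_enum.
have hc0 : h.[c i0] != 0.
  rewrite horner_prod prodf_seq_neq0; apply/allP=> i _; apply/implyP => ii0.
  by rewrite hornerXsubC subr_eq0 (inj_eq inj_c) eq_sym.
have sh : (size h <= n)%N.
  have -> : size h = m.
    rewrite /h -big_filter size_prod_XsubC size_filter -sum1_count sum1dep_card.
    by rewrite cardsE cardC1 card_ord prednK.
  by rewrite -(prednK m_gt0).
pose k x := (x / h.[c i0]) *: h.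
have sk x : (size (k x) <= n)%N by rewrite (leq_trans (size_scale_leq _ _)).
pose R g := chi (\prod_(i | i != i0) g.[c i] ^+ a i).
have twistE (g : {poly F}) x : twist (g + k x) = chi ((g.[c i0] + x) ^+ a i0) * R g.
  rewrite /twist (bigD1 i0) //= chiM hornerD hornerZ divfK //; congr (_ * chi _).
  by apply: eq_bigr => i ii0; rewrite hornerD [(k x).[_]]hornerZ (hc i ii0) mulr0 addr0.
(* Average over translations: p copies of the coefficient, the x-th one reindexed by adding
   [k x]. *)
apply: (mulfI (_ : p%:R != 0 :> C)); first by rewrite pnatr_eq0 -lt0n prime_gt0.
rewrite mulr0 mulr_natl -sumr_const.
transitivity (\sum_(x : F) \sum_(v : 'rV[F]_n) twist ('X^n + rVpoly v + k x)).
  apply: eq_bigr => x _; rewrite /lseries big_map big_enum /=.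
  rewrite (reindex_inj (addIr (poly_rV (k x)))) /=; apply: eq_bigr => v _.
  by rewrite linearD /= poly_rV_K // addrA.
rewrite exchange_big big1 // => v _.
under eq_bigr do rewrite twistE.
rewrite -mulr_suml; have := sum_chiX (co_al i0).
by rewrite (reindex_inj (addrI ('X^n + rVpoly v).[c i0])) /= => ->; rewrite mul0r.
Qed.

Definition weil_poly : {poly F} := \prod_i ((c i)%:P - 'X) ^+ a i.

Lemma size_weil_poly : size weil_poly = (\sum_i a i).+1.
Proof.
have sX i : size ((c i)%:P - 'X) = 2 by rewrite -opprB size_polyN size_XsubC.
have sXa i : size (((c i)%:P - 'X) ^+ a i) = (a i).+1.
  have E := size_exp ((c i)%:P - 'X) (a i); rewrite sX mul1n in E.
  by rewrite -[in RHS]E prednK // size_poly_gt0 expf_neq0 // -size_poly_eq0 sX.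
rewrite size_prod => [|i _]; last by rewrite -size_poly_eq0 sXa.
under eq_bigr do rewrite sXa -addn1.
by rewrite big_split /= sum1_card card_ord -addSn addnK.
Qed.

Section Extension.

Variables (L : finFieldType) (iota : {rmorphism F -> L}) (n : nat).
Hypotheses (n_gt0 : (0 < n)%N) (card_L : #|L| = (p ^ n)%N).

(* The norm of f(x) from L down to F. *)
Definition weil_norm (x : L) : F :=
  odflt 0 [pick v | iota v == (map_poly iota weil_poly).[x] ^+ (\sum_(i < n) p ^ i)].

Lemma weil_normE P x : map_poly iota P = conj_poly F x ->
  iota ((\prod_i P.[c i] ^+ a i) ^+ (n %/ order (@frob F L) x)) =
    (map_poly iota weil_poly).[x] ^+ (\sum_(i < n) p ^ i).
Proof.
move=> PE; rewrite -prodrXl rmorph_prod /= rmorph_prod horner_prod -prodrXl.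
apply: eq_bigr => i _; rewrite exprAC [LHS]rmorphXn /=.
rewrite (conj_poly_norm p_prime card_L (c i) PE).
by rewrite rmorphXn rmorphB /= map_polyC map_polyX !hornerE exprAC.
Qed.

Lemma iota_weil_norm x :
  iota (weil_norm x) = (map_poly iota weil_poly).[x] ^+ (\sum_(i < n) p ^ i).
Proof.
rewrite /weil_norm; case: pickP => [v /eqP //|none].
have [P PE] := conj_poly_descends iota p_prime card_L x.
have := none ((\prod_i P.[c i] ^+ a i) ^+ (n %/ order (@frob F L) x)).
by rewrite /= (weil_normE PE) eqxx.
Qed.

(** The factor d in front of each irreducible P of degree d counts its roots x in [L], and [twist P]
    to the power n/d is chi of the norm of f(x). *)
Lemma prime_powers_sum : prime_powers twist n = \sum_x chi (weil_norm x).
Proof.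
pose H (P : {poly F}) := twist P ^+ (n %/ (size P).-1).
rewrite (sum_over_conjugates (iota := iota) p_prime card_L (H := H)) //; last first.
  move=> P x PE; rewrite /H -(size_map_poly iota) PE size_conj_poly -chiX.
  congr chi; apply: (fmorph_inj iota).
  by rewrite iota_weil_norm (weil_normE PE).
apply: eq_bigr => d _; apply: eq_big_seq => P /mem_irrs[_ _ sP].
by rewrite /H sP.
Qed.

End Extension.

Lemma twist_weil : prime_powers twist 1 = \sum_x chi weil_poly.[x].
Proof.
have card_F : #|F| = (p ^ 1)%N by rewrite expn1.
rewrite (prime_powers_sum idfun _ card_F) //.
apply: eq_bigr => x _; congr chi.
have := iota_weil_norm idfun card_F x; rewrite big_ord1 expn0 expr1 => /= ->.
by rewrite map_poly_id.
Qed.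

Local Notation d := (\sum_i a i)%N.

(** The nonzero norms split into l classes by the value of chi. Each class has at most Q^2/l + O(Q)
    elements by Stepanov and together they have Q^2 - O(1), so they are equidistributed up to
    O(Q). *)
Lemma prime_powers_bound k : (0 < k)%N ->
    (d * d * l + 2 * d * l + 2 * d + 2 <= (p ^ k).-1 %/ l)%N ->
  `|prime_powers twist (k + k)| <= (l * (2 * d + 2) + 1 + d)%:R * p%:R ^+ k.
Proof.
move=> k_gt0 r_big; pose Q := (p ^ k)%N; pose r := (Q.-1 %/ l)%N.
have kk : (0 < k + k)%N by rewrite addn_gt0 k_gt0.
have [L [iota card_L]] := extensions kk.
rewrite (prime_powers_sum iota kk card_L).
have [v v0 prim_w] := chi_primitive; set w := chi v in prim_w.
pose wn := weil_norm iota (k + k).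
pose N (j : 'I_l) := #|[set x : L | chi (wn x) == w ^+ j]|.
pose Z := #|[set x : L | wn x == 0]|.
have p_gt0 : (0 < p)%N by apply: prime_gt0.
have Q_gt0 : (0 < Q)%N by rewrite expn_gt0 p_gt0.
have l_dvdQ : (l %| Q.-1)%N by rewrite predn_exp dvdn_mulr.
have QE : Q = (l * r).+1 by rewrite mulnC divnK // prednK.
(* The norm followed by the e-th power is the exponent (Q^2 - 1)/l of Stepanov's bound. *)
have expE : ((\sum_(i < k + k) p ^ i) * e = r * Q.+1)%N.
  apply/eqP; rewrite -(eqn_pmul2l (prime_gt0 l_prime)); apply/eqP.
  have -> : (l * (r * Q.+1) = (p ^ (k + k)).-1)%N.
    by rewrite expnD -/Q QE mulnA [in RHS]mulSn addSn /= -mulnS.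
  by rewrite predn_exp mulnCA [(l * e)%N]mulnC divnK // mulnC.
have chi_wn x : wn x != 0 -> exists j : 'I_l, chi (wn x) = w ^+ j.
  by move=> /chiXl /(prim_rootP prim_w)[j jE]; exists j.
have w0 j : w ^+ j != 0 by rewrite -chiX chi_neq0 ?expf_neq0.
have wn_indicator (y : 'I_l -> C) x : wn x != 0 ->
    exists2 j0 : 'I_l, chi (wn x) = w ^+ j0 &
    \sum_(j < l) (if chi (wn x) == w ^+ j then y j else 0) = y j0.
  case/chi_wn => j0 jE; exists j0 => //.
  rewrite (bigD1 j0) //= jE eqxx big1 ?addr0 // => j jj0.
  rewrite (eq_prim_root_expr prim_w) !modn_small // eq_sym.
  by rewrite -val_eqE in jj0; rewrite (negPf jj0).
have sum_N (y : 'I_l -> C) :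
    \sum_x \sum_(j < l) (if chi (wn x) == w ^+ j then y j else 0) =
    \sum_(j < l) y j *+ N j.
  rewrite exchange_big; apply: eq_bigr => j _ /=.
  by rewrite -big_mkcond sumr_const /N cardsE.
have wn0 (y : 'I_l -> C) x : wn x = 0 ->
    \sum_(j < l) (if chi (wn x) == w ^+ j then y j else 0) = 0.
  move=> E; rewrite big1 // => j _; rewrite E chi0 eq_sym.
  by rewrite (negPf (w0 j)).
have sumE : \sum_x chi (wn x) = \sum_(j < l) w ^+ j *+ N j.
  rewrite -sum_N; apply: eq_bigr => x _.
  have [E|/wn_indicator] := eqVneq (wn x) 0; first by rewrite wn0 ?E.
  by case/(_ (fun j : 'I_l => w ^+ j)) => j0 -> ->.
have countE : (#|L|%:R = Z%:R + \sum_(j < l) (N j)%:R :> C).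
  rewrite -sum_N -sum1_card natr_sum /Z -sum1_card natr_sum [X in X + _]big_mkcond.
  rewrite -big_split /=; apply: eq_bigr => x _; rewrite inE.
  have [E|/wn_indicator] := eqVneq (wn x) 0; first by rewrite wn0 // addr0.
  by case/(_ (fun=> 1)) => j0 _ ->; rewrite add0r.
have stepanov j : (l * N j <= Q * Q + (l * (2 * d + 2) + 1) * Q)%N.
  have := stepanov_bound iota p_prime card_L ((v ^+ j) ^+ e)
    (prime_gt1 l_prime) QE size_weil_poly co_dl r_big.
  apply: leq_trans; rewrite leq_mul2l; apply/orP; right; apply: subset_leq_card.
  apply/subsetP=> x; rewrite !inE => /eqP wx.
  have wx0 : wn x != 0.
    by apply: contraTneq isT => E; move: (w0 j); rewrite -wx E chi0 eqxx.
  rewrite -expE exprM -(iota_weil_norm iota card_L) -rmorphXn /=.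
  apply/eqP; congr (iota _); have vj0 : v ^+ j != 0 by apply: expf_neq0.
  (* Equal values of chi mean a quotient in the kernel, hence equal e-th powers: zeta is (v^j)^e. *)
  have : chi (wn x / v ^+ j) == 1.
    apply/eqP/(mulIf (chi_neq0 vj0)).
    by rewrite -chiM divfK // mul1r wx chiX.
  rewrite chi_eq1 => /andP[_]; rewrite expr_div_n => /eqP E.
  by rewrite -[RHS]mul1r -E divfK // expf_neq0.
have Zd : (Z <= d)%N.
  rewrite -ltnS -size_weil_poly -(size_map_poly iota) /Z cardE.
  apply: max_poly_roots; last exact: enum_uniq.
    by rewrite map_poly_eq0 -size_poly_eq0 size_weil_poly.
  apply/allP=> x; rewrite mem_enum inE => /eqP E.
  have := iota_weil_norm iota card_L x; rewrite -/(wn x) E rmorph0.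
  by move/esym/eqP; rewrite expf_eq0 => /andP[].
pose B := (Q * Q + (l * (2 * d + 2) + 1) * Q)%N.
have sum_w : \sum_(j < l) w ^+ j = 0.
  have := subrX1 w l; rewrite (prim_expr_order prim_w) subrr => /esym/eqP.
  rewrite mulf_eq0 subr_eq0 => /orP[/eqP w1|/eqP //].
  by move: (prim_order_dvd prim_w 1); rewrite w1 expr1n eqxx dvdn1 gtn_eqF ?prime_gt1.
rewrite -[X in `|X|]/(\sum_x chi (wn x)) sumE.
rewrite -(@ler_pM2l _ l%:R) ?ltr0n ?prime_gt0 //.
(* As the w^j sum to zero, l N_j may be replaced by its defect from B. The defects are nonnegative,
   so the triangle inequality only costs their total. *)
have -> : l%:R * `|\sum_(j < l) w ^+ j *+ N j| =
    `|\sum_(j < l) w ^+ j * (B - l * N j)%:R|.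
  rewrite -[l%:R]normr_nat -normrM -[RHS]normrN; congr `|_|.
  apply/eqP; rewrite -addr_eq0 mulr_sumr -big_split /=.
  rewrite (eq_bigr (fun j : 'I_l => B%:R * w ^+ j)); last first.
    by move=> j _; rewrite natrB // natrM -mulr_natr; ring.
  by rewrite -mulr_sumr sum_w mulr0.
apply: le_trans (ler_norm_sum _ _ _) _.
rewrite (eq_bigr (fun j : 'I_l => B%:R - l%:R * (N j)%:R)); last first.
  by move=> j _; rewrite normrM normrX norm_chi // expr1n mul1r normr_nat natrB // natrM.
rewrite sumrB sumr_const card_ord -[B%:R *+ l]mulr_natl -mulr_sumr -mulrBr.
rewrite ler_pM2l ?ltr0n ?prime_gt0 //.
have -> : \sum_(j < l) (N j)%:R = (Q * Q)%:R - Z%:R :> C.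
  by apply/eqP; rewrite eq_sym subr_eq addrC -countE card_L expnD.
rewrite -natrX -natrM opprB addrA -natrD lerBlDr -natrD ler_nat /B -/Q.
have ZQ : (Z <= d * Q)%N by rewrite (leq_trans Zd) // leq_pmulr.
by rewrite [((_ + 1 + d) * Q)%N]mulnDl [leqRHS]addnC addnA leq_add2l.
Qed.

Lemma weil_bound : `|\sum_x chi weil_poly.[x]| <= m.-1%:R * sqrtC p%:R.
Proof.
rewrite -twist_weil.
pose R0 := (d * d * l + 2 * d * l + 2 * d + 2)%N.
(* For k >= (R0 + 1) l, p^k > k gives (p^k - 1)/l >= R0, the size that Stepanov's bound asks of
   r. *)
apply: (@power_trick (lseries twist) _ _ _ (l * (2 * d + 2) + 1 + d)%:R (R0.+1 * l)%N).
- rewrite /lseries (perm_big [:: 1]) ?big_seq1 ?twist1 //; apply: uniq_perm => //.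
    exact: uniq_monics.
  move=> g; rewrite mem_monics inE; apply/andP/eqP => [[mong /size_poly1P[y _ gE]]|->].
    by move: mong; rewrite gE monicE lead_coefC => /eqP ->.
  by rewrite monic1 size_poly1.
- exact: lseries_twist0.
- exact: lseries_rec twistM twist1.
- by rewrite ltr0n prime_gt0.
move=> k kR; apply: prime_powers_bound.
  by apply: leq_trans kR; rewrite muln_gt0 (prime_gt0 l_prime).
rewrite -/R0 leq_divRL ?prime_gt0 // -ltnS prednK ?expn_gt0 ?prime_gt0 //.
have := ltn_expl k (prime_gt1 p_prime); have := prime_gt0 l_prime; nia.
Qed.

End WeilBound.

(** * Character sums with arbitrary exponents and the count of kernel windows *)

Section CharacterSums.

Local Notation C := algC.
Variables (F : finFieldType) (l : nat) (chi : F -> C).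
Local Notation p := #|F|.
Local Notation e := (p.-1 %/ l)%N.
Hypothesis p_prime : prime p.
Hypothesis extensions : forall n, (0 < n)%N ->
  exists (L : finFieldType) (iota : {rmorphism F -> L}), #|L| = (p ^ n)%N.
Hypotheses (l_prime : prime l) (l_dvd : (l %| p.-1)%N).
Hypothesis chiM : {morph chi : x y / x * y}.
Hypothesis chi0 : chi 0 = 0.
Hypothesis chi_eq1 : forall v, (chi v == 1) = (v != 0) && (v ^+ e == 1).

Lemma norm_chi_le1 v : `|chi v| <= 1.
Proof.
have [->|v0] := eqVneq v 0; first by rewrite chi0 normr0 ler01.
by rewrite (norm_chi p_prime l_prime l_dvd chiM chi_eq1 v0).
Qed.

Lemma sqrt_card_ge1 : 1 <= sqrtC p%:R :> C.
Proof.
rewrite -[X in X <= _]sqrtC1 ler_sqrtC ?nnegrE ?ler01 ?ler0n //.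
by rewrite ler1n prime_gt0.
Qed.

Lemma weil_bound_ord m (c : 'I_m -> F) (a : 'I_m -> nat) :
    (0 < m)%N -> injective c -> (forall i, coprime (a i) l) ->
  `|\sum_x chi (\prod_i (c i - x) ^+ a i)| <= m.-1%:R * sqrtC p%:R.
Proof.
move=> m_gt0 inj_c co_al.
have polyE m' (c' : 'I_m' -> F) (a' : 'I_m' -> nat) x :
    \prod_i (c' i - x) ^+ a' i = (weil_poly c' a').[x].
  by rewrite horner_prod; apply: eq_bigr => i _; rewrite !hornerE.
have [|] := boolP (coprime (\sum_i a i) l).
  move=> co; under eq_bigr do rewrite polyE.
  exact: (weil_bound p_prime extensions l_prime l_dvd chiM chi0 chi_eq1).
rewrite coprime_sym prime_coprime // negbK.
(* If l divides the degree, the substitution x = c_0 + 1/w removes the point c_0. *)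
case: m m_gt0 c a inj_c co_al => // m _ c a inj_c co_al l_dvd_sum.
have [c'_neq0 inj_c'] : (forall i : 'I_m, c (lift ord0 i) - c ord0 != 0) /\
    injective (fun i : 'I_m => (c (lift ord0 i) - c ord0)^-1).
  split=> [i|i j /invr_inj /addIr /inj_c /lift_inj //].
  by rewrite subr_eq0 (inj_eq inj_c) eq_sym neq_lift.
case: m => [|m] in c a inj_c co_al l_dvd_sum c'_neq0 inj_c' *.
  move: l_dvd_sum (co_al ord0); rewrite big_ord_recl big_ord0 addn0.
  by move=> ?; rewrite coprime_sym prime_coprime // => /negP.
pose c' i := (c (lift ord0 i) - c ord0)^-1; pose a' (i : 'I_m.+1) := a (lift ord0 i).
pose k := (-1) ^+ (\sum_i a i) * \prod_i (c (lift ord0 i) - c ord0) ^+ a' i.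
(* The substitution extracts a power of 1/w whose exponent is a multiple of l, hence invisible to
   chi. *)
have termE w : w != 0 -> chi (\prod_i (c i - (c ord0 + w^-1)) ^+ a i) =
    chi k * chi (\prod_i (c' i - w) ^+ a' i).
  move=> w0; rewrite -chiM.
  have -> : \prod_i (c i - (c ord0 + w^-1)) ^+ a i =
     w^-1 ^+ (\sum_i a i) * (k * \prod_i (c' i - w) ^+ a' i).
    pose S := (\sum_(i < m.+1) a' i)%N.
    have SE : (\sum_i a i)%N = (a ord0 + S)%N by rewrite big_ord_recl.
    rewrite big_ord_recl /k SE.
    rewrite (eq_bigr (fun i => (- w^-1) ^+ a' i * ((c (lift ord0 i) - c ord0) ^+ a' i *
      (c' i - w) ^+ a' i))); last first.
      move=> i _; rewrite -!exprMn; congr (_ ^+ _); rewrite /c'.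
      have := c'_neq0 i; set u := c _ - c ord0 => u0.
      by rewrite opprD addrA -/u; field; rewrite u0 w0.
    rewrite !big_split /= prodrXr -/S opprD addrA subrr add0r.
    rewrite !exprD -[- w^-1]mulN1r !exprMn; ring.
  rewrite [LHS]chiM -[RHS]mul1r; congr (_ * _).
  have /dvdnP[s ->] := l_dvd_sum; rewrite exprM (chiX chiM chi_eq1).
  by apply: (chiXl p_prime l_dvd chiM chi_eq1); rewrite expf_neq0 ?invr_neq0.
have a0_gt0 : (0 < a ord0)%N.
  rewrite lt0n; apply: contraL (co_al ord0) => /eqP ->.
  by rewrite /coprime gcd0n gtn_eqF ?prime_gt1.
(* Since 0^-1 = 0, the substitution permutes [F]; it sends w = 0 to c_0, where the product
   vanishes. *)
have inj_h : injective (fun w => c ord0 + w^-1) by move=> w1 w2 /addrI /invr_inj.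
rewrite (reindex_inj inj_h) (bigD1 0) //= invr0 addr0 big_ord_recl subrr expr0n.
rewrite gtn_eqF // mul0r chi0 add0r.
rewrite (eq_bigr (fun w => chi k * chi (\prod_i (c' i - w) ^+ a' i))); last first.
  by move=> w /termE.
rewrite -mulr_sumr normrM.
have S_co : coprime (\sum_i a' i) l.
  rewrite coprime_sym prime_coprime //; apply: contraL (co_al ord0) => dvdS.
  rewrite coprime_sym prime_coprime // negbK.
  by move: l_dvd_sum; rewrite big_ord_recl dvdn_addl.
have := weil_bound p_prime extensions l_prime l_dvd chiM chi0 chi_eq1
  (ltn0Sn m) inj_c' (fun i => co_al (lift ord0 i)) S_co.
rewrite -/c' -/a'.
under eq_bigr do rewrite -polyE.
rewrite (bigD1 0) //= => bound.
apply: le_trans (_ : `|\sum_(w | w != 0) chi (\prod_i (c' i - w) ^+ a' i)| <= _).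
  by rewrite ler_piMl ?norm_chi_le1.
set X := chi _ in bound; set Y := \sum_(w | _) _ in bound *.
(* The missing term w = 0 has norm at most 1 <= sqrt p, which is paid for by the point that was
   removed. *)
have -> : Y = (X + Y) - X by rewrite addrC addKr.
rewrite (le_trans (ler_normB _ _)) // mulrSr mulrDl mul1r lerD //.
by rewrite (le_trans (norm_chi_le1 _)) // sqrt_card_ge1.
Qed.

(** Indices with exponent 0 contribute the factor 1; a nonzero exponent below the prime l is prime
    to l. *)
Lemma weil_bound_support h (c : 'I_h -> F) (a : 'I_h -> nat) :
    injective c -> (forall i, (a i < l)%N) -> (exists i, a i != 0%N) ->
  `|\sum_x chi (\prod_i (c i - x) ^+ a i)| <= h.-1%:R * sqrtC p%:R.
Proof.
move=> inj_c al [i0 ai0]; pose J := [set i | a i != 0%N].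
rewrite (eq_bigr (fun x : F => chi (\prod_(k < #|J|)
    (c (enum_val k) - x) ^+ a (enum_val k)))); last first.
  move=> x _; congr chi; rewrite -(big_enum_val (fun i => ((c i - x) ^+ a i)%R)).
  rewrite [RHS]big_mkcond; apply: eq_bigr => i _; rewrite inE.
  by case: eqP => // ->; rewrite expr0.
have J_gt0 : (0 < #|J|)%N by apply/card_gt0P; exists i0; rewrite inE.
apply: le_trans (weil_bound_ord J_gt0 _ _) _.
- by move=> k1 k2 /inj_c /enum_val_inj.
- move=> k; have := enum_valP k; rewrite inE => ak.
  rewrite coprime_sym prime_coprime //; apply/negP => /dvdn_leq.
  by rewrite lt0n ak leqNgt al => /(_ isT).
rewrite ler_wpM2r ?(le_trans ler01 sqrt_card_ge1) // ler_nat.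
by rewrite -!subn1 leq_sub2r // -[leqRHS]card_ord max_card.
Qed.

(** The sum [I1] of chi(v^j) over j < l is l on the kernel, 1 at v = 0 and 0 elsewhere. Multiply
    over the h points and expand: the zero exponent vector gives p, any other at most (h - 1) sqrt
    p. Thus N l^h <= p + l^h (h - 1) sqrt p, and p <= 4^h <= l^(2h) gives p <= l^h sqrt p. *)
Lemma count_all_one h (c : 'I_h -> F) : (0 < h)%N -> injective c ->
    (p <= 4 ^ h)%N ->
  (#|[set x : F | [forall i, (chi (c i - x) == 1)%R]]| ^ 2 <= h ^ 2 * p)%N.
Proof.
move=> h_gt0 inj_c p_le; set N := #|_|.
have p_gt0 : (0 < p)%N by apply: prime_gt0.
have l_gt0 : 0 < l%:R :> C by rewrite ltr0n prime_gt0.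
pose I1 v := \sum_(j < l) chi (v ^+ j).
have I1_ge0 v : 0 <= I1 v.
  rewrite /I1; have [->|v0] := eqVneq v 0.
    apply: sumr_ge0 => j _; rewrite expr0n; case: eqP => _.
      by rewrite (chi1 chi_eq1) ler01.
    by rewrite chi0.
  under eq_bigr do rewrite (chiX chiM chi_eq1).
  have [->|v1] := eqVneq (chi v) 1.
    by apply: sumr_ge0 => j _; rewrite expr1n.
  have := subrX1 (chi v) l; rewrite (chiXl p_prime l_dvd chiM chi_eq1) // subrr.
  by move/esym/eqP; rewrite mulf_eq0 subr_eq0 (negPf v1) => /eqP ->.
have I1_1 v : chi v = 1 -> I1 v = l%:R.
  move=> v1; rewrite /I1; under eq_bigr do rewrite (chiX chiM chi_eq1) v1 expr1n.
  by rewrite sumr_const card_ord.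
have lower : N%:R * l%:R ^+ h <= \sum_x \prod_i I1 (c i - x).
  rewrite /N -sum1_card natr_sum mulr_suml big_mkcond; apply: ler_sum => x _.
  case: ifP => [|_]; last by apply: prodr_ge0.
  rewrite inE => /forallP all1; rewrite mul1r.
  rewrite (eq_bigr (fun _ => l%:R)) ?prodr_const ?card_ord //.
  by move=> i _; apply/I1_1/eqP.
have total_ge0 : 0 <= \sum_x \prod_i I1 (c i - x).
  by apply: sumr_ge0 => x _; apply: prodr_ge0.
have [S' totE S'_le] : exists2 S' : C, \sum_x \prod_i I1 (c i - x) = p%:R + S' &
    `|S'| <= l%:R ^+ h * (h.-1%:R * sqrtC p%:R).
  under eq_bigr do rewrite bigA_distr_bigA.
  rewrite exchange_big /= (bigD1 [ffun=> Ordinal (prime_gt0 l_prime)]) //=.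
  set S' := (X in _ + X); exists S'.
    congr (_ + _); rewrite -sum1_card natr_sum; apply: eq_bigr => x _.
    by rewrite big1 // => i _; rewrite ffunE expr0 (chi1 chi_eq1).
  rewrite (le_trans (ler_norm_sum _ _ _)) //.
  apply: le_trans (_ : \sum_(f : {ffun 'I_h -> 'I_l}) h.-1%:R * sqrtC p%:R <= _).
    rewrite big_mkcond; apply: ler_sum => f _; case: ifP => [f0|_].
      under eq_bigr do rewrite -(chi_prod chiM chi_eq1).
      apply: weil_bound_support => //; apply/existsP; apply: contraR f0.
      rewrite negb_exists => /forallP all0; apply/eqP/ffunP=> i; apply/val_inj.
      by rewrite ffunE /=; have := all0 i; rewrite negbK => /eqP.
    by rewrite mulr_ge0 ?ler0n ?(le_trans ler01 sqrt_card_ge1).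
  by rewrite sumr_const card_ffun !card_ord -[leLHS]mulr_natl natrX.
have S'_real : S' \is Num.real.
  rewrite (_ : S' = \sum_x \prod_i I1 (c i - x) - p%:R) ?rpredB ?ger0_real ?ler0n //.
  by rewrite totE addrC addKr.
have s_ge0 : 0 <= sqrtC p%:R :> C := le_trans ler01 sqrt_card_ge1.
have p_le_l : p%:R <= l%:R ^+ h * sqrtC p%:R :> C.
  rewrite -[X in X <= _]sqrtCK expr2 ler_wpM2r // (@le_trans _ _ (2 ^+ h)) //.
    rewrite -(@ler_pXn2r _ 2) ?nnegrE ?exprn_ge0 ?ler0n // sqrtCK -exprM mulnC exprM.
    by rewrite -natrX -natrX ler_nat.
  by rewrite lerXn2r ?nnegrE ?ler0n // ler_nat prime_gt1.
have N_le : N%:R <= h%:R * sqrtC p%:R :> C.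
  rewrite -(@ler_pM2r _ (l%:R ^+ h)) ?exprn_gt0 // (le_trans lower) // totE.
  apply: le_trans (_ : l%:R ^+ h * sqrtC p%:R + l%:R ^+ h * (h.-1%:R * sqrtC p%:R) <= _).
    by rewrite lerD // (le_trans (real_ler_norm S'_real)).
  have -> : h%:R = h.-1%:R + 1 :> C by rewrite natr1 prednK.
  by rewrite le_eqVlt; apply/orP; left; apply/eqP; ring.
rewrite -(ler_nat C) natrM !natrX -[X in _ <= _ * X]sqrtCK -exprMn.
by rewrite lerXn2r ?nnegrE ?mulr_ge0 ?ler0n.
Qed.

End CharacterSums.

(** * Specialization to the prime field *)

Section PrimeField.

Variable p : nat.
Hypothesis p_prime : prime p.

Lemma Fp_extension n : (0 < n)%N ->
  exists (L : finFieldType) (iota : {rmorphism 'F_p -> L}), #|L| = (p ^ n)%N.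
Proof.
move=> n_gt0; have [L pchar_L card_L] := pPrimePowerField p_prime n_gt0.
by exists (pPrimeCharType pchar_L), (in_alg (pPrimeCharType pchar_L)).
Qed.

Lemma Fp_primitive_root : exists g : 'F_p, p.-1.-primitive_root g.
Proof.
have p1_gt0 : (0 < p.-1)%N by rewrite -ltnS prednK ?prime_gt0 ?prime_gt1.
have card_nz : size (enum [pred v : 'F_p | v != 0]) = p.-1.
  by rewrite -cardE (cardC1 (0 : 'F_p)) card_Fp.
have := @cyclic.has_prim_root _ p.-1 (enum [pred v : 'F_p | v != 0]).
case/(_ p1_gt0 _ (enum_uniq _) _)/hasP.
- apply/allP=> v; rewrite mem_enum inE => v0; apply/unity_rootP.
  by apply: (mulfI v0); rewrite mulr1 -exprS prednK ?prime_gt0 // -{2}(expf_card v) card_Fp.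
- by rewrite card_nz.
by move=> g _ prim_g; exists g.
Qed.

(** The discrete logarithm to a primitive root, read in the l-th roots of unity. *)
Lemma Fp_character l : prime l -> (l %| p.-1)%N ->
  exists chi : 'F_p -> algC, [/\ {morph chi : x y / x * y}, chi 0 = 0
    & forall v, (chi v == 1) = (v != 0) && (v ^+ (p.-1 %/ l) == 1)].
Proof.
move=> l_prime l_dvd; have [g prim_g] := Fp_primitive_root.
have [w prim_w] := C_prim_root_exists (prime_gt0 l_prime).
have p1_gt0 := prim_order_gt0 prim_g.
have log v : {i | v != 0 -> v = g ^+ i}.
  have [->|v0] := eqVneq v 0; first by exists 0%N.
  have [|i vE] := prim_rootP prim_g (_ : v ^+ p.-1 = 1); last by exists (i : nat).
  by apply: (mulfI v0); rewrite mulr1 -exprS prednK ?prime_gt0 // -{2}(expf_card v) card_Fp.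
have [lg lgE] : exists lg : 'F_p -> nat, forall v, v != 0 -> v = g ^+ lg v.
  by exists (fun v => sval (log v)) => v; exact: (svalP (log v)).
pose chi v := if v == 0 then 0 else w ^+ lg v; exists chi.
have g0 : g != 0 by rewrite (prim_root_eq0 prim_g) gtn_eqF.
split; last 2 first.
- by rewrite /chi eqxx.
- move=> v; rewrite /chi; have [->|v0] /= := eqVneq v 0; first by rewrite eq_sym oner_eq0.
  rewrite -(prim_order_dvd prim_w) {2}(lgE v v0) -exprM -(prim_order_dvd prim_g).
  by rewrite -{1}(divnK l_dvd) mulnC dvdn_pmul2r // divn_gt0 ?prime_gt0 // dvdn_leq.
move=> x y; rewrite /chi mulf_eq0.
have [_|x0] := eqVneq x 0; first by rewrite mul0r.
have [_|y0] /= := eqVneq y 0; first by rewrite mulr0.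
rewrite -exprD; apply/eqP; rewrite (eq_prim_root_expr prim_w).
have xy0 : x * y != 0 by rewrite mulf_neq0.
have : g ^+ lg (x * y) == g ^+ (lg x + lg y).
  by rewrite exprD -(lgE x x0) -(lgE y y0) -(lgE _ xy0).
rewrite (eq_prim_root_expr prim_g) => /eqP E; apply/eqP.
by rewrite -(modn_dvdm _ l_dvd) E modn_dvdm.
Qed.

(** Apply the count to the points 0, ..., h - 1, replacing x by -x to turn j - x into x + j. *)
Lemma count_power_windows l h : prime l -> (l %| p.-1)%N ->
    (0 < h <= p)%N -> (p <= 4 ^ h)%N ->
  (#|[set x : 'F_p | [forall j : 'I_h, ((x + j%:R) ^+ (p.-1 %/ l) == 1)%R]]| ^ 2
     <= h ^ 2 * p)%N.
Proof.
move=> l_prime l_dvd /andP[h_gt0 hp] p_le.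
have [chi [chiM chi0 chi_eq1]] := Fp_character l_prime l_dvd.
have inj_c : injective (fun j : 'I_h => j%:R : 'F_p).
  move=> i j /(congr1 (@nat_of_ord _)); rewrite !val_Fp_nat // !modn_small.
  - exact: val_inj.
  - exact: leq_trans (ltn_ord j) hp.
  - exact: leq_trans (ltn_ord i) hp.
have := @count_all_one 'F_p l chi; rewrite !card_Fp // => count.
have {}count := count p_prime Fp_extension l_prime l_dvd chiM chi0 chi_eq1 h _ h_gt0 inj_c p_le.
apply: leq_trans count.
rewrite leq_exp2r // -(card_imset _ (@oppr_inj 'F_p)); apply: subset_leq_card.
apply/subsetP=> _ /imsetP[x + ->]; rewrite !inE => /forallP allx.
apply/forallP=> j; rewrite opprK addrC chi_eq1 allx andbT.
have e_gt0 : (0 < p.-1 %/ l)%N.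
  by rewrite divn_gt0 ?prime_gt0 // dvdn_leq // -ltnS prednK ?prime_gt0 ?prime_gt1.
apply/negP => /eqP E; move: (allx j); rewrite E expr0n gtn_eqF //=.
Qed.

End PrimeField.

(** * Windows of consecutive elements of the kernel *)

Section TotientSum.

Local Open Scope nat_scope.

(** The quotient Y / d counts the multiples of d up to Y, so this sums the identity n = sum of
    phi(d) over d dividing n. *)
Lemma sum_totient_divn Y N : Y <= N ->
  2 * \sum_(1 <= d < N.+1) totient d * (Y %/ d) = Y * Y.+1.
Proof.
elim: Y => [|Y IHY] YN.
  by rewrite big1 ?muln0 // => d _; rewrite div0n muln0.
have -> : \sum_(1 <= d < N.+1) totient d * (Y.+1 %/ d) =
    \sum_(1 <= d < N.+1) totient d * (Y %/ d) + Y.+1.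
  have dvdE : \sum_(1 <= d < N.+1) (d %| Y.+1) * totient d = Y.+1.
    rewrite -[RHS](sum_totient_dvd Y.+1) -(big_mkord (fun d => d %| Y.+1)).
    rewrite [RHS]big_ltn_cond //= [LHS](@big_cat_nat _ _ _ Y.+2 1 N.+1) //=.
    rewrite [X in _ + X]big_nat [X in _ + X]big1 ?addn0 => [|d /andP[Yd _]]; last first.
      by rewrite gtnNdvd.
    by rewrite [RHS]big_mkcond; apply: eq_bigr => d _; case: (d %| _); rewrite ?mul1n.
  rewrite -[X in _ = _ + X]dvdE.
  rewrite -big_split; apply: eq_big_nat => d /andP[d_gt0 _] /=.
  by rewrite divnS //; ring.
by rewrite mulnDr IHY ?(ltnW YN) //; ring.
Qed.

(* With S(Y) = sum_d phi(d) floor(Y/d) = Y(Y+1)/2, compare S(X) and 2 S(X/2). *)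
Lemma sum_totient_lower X : X ^ 2 <= 4 * \sum_(1 <= q < X.+1) totient q.
Proof.
pose S Y := \sum_(1 <= d < X.+1) totient d * (Y %/ d).
have S1 : 2 * S X = X * X.+1 by apply: sum_totient_divn.
have S2 : 2 * S X./2 = X./2 * (X./2).+1.
  by apply: sum_totient_divn; rewrite -divn2 leq_div.
have : S X <= 2 * S X./2 + \sum_(1 <= q < X.+1) totient q.
  rewrite /S big_distrr -big_split; apply: leq_sum => d _ /=.
  have : X %/ d <= 2 * (X./2 %/ d) + 1.
    rewrite -divn2 -divnMA [2 * d]mulnC divnMA divn2.
    have := odd_double_half (X %/ d); lia.
  nia.
(* S(X) - 2 S(n) equals n^2 for X = 2n and (n + 1)^2 for X = 2n + 1. *)
have := odd_double_half X; set n := X./2 in S2 *; set T := \sum_(1 <= q < X.+1) _ => XE le_S.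
nia.
Qed.

(** The multiples of u number at most X/u and each totient is at most X, which leaves 1/4 - 1/40 =
    9/40 of X^2. *)
Lemma sum_totient_not_dvd u X : 40 <= u ->
  9 * X ^ 2 <= 40 * \sum_(1 <= q < X.+1 | ~~ (u %| q)) totient q.
Proof.
move=> u40.
have := sum_totient_lower X; rewrite (bigID (fun q => u %| q)) /=.
have : \sum_(1 <= q < X.+1 | u %| q) totient q <= X * (X %/ u).
  apply: leq_trans (_ : \sum_(1 <= q < X.+1) (u %| q) * X <= _).
    rewrite big_mkcond big_nat [leqRHS]big_nat; apply: leq_sum => q /andP[q0 qX].
    case: ifP => _ //; rewrite mul1n; apply: leq_trans (_ : q <= X) => //.
    rewrite totient_count_coprime -[leqRHS]muln1 -[q in leqRHS]subn0 -sum_nat_const_nat.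
    by apply: leq_sum => i _; apply: leq_b1.
  rewrite -big_distrl /= mulnC (_ : \sum_(1 <= q < X.+1) (u %| q) = X %/ u) //.
  elim: (X) => [|Y IHY]; first by rewrite big_geq ?div0n.
  by rewrite big_nat_recr //= IHY divnS 1?addnC // (leq_trans _ u40).
have := leq_trunc_div X u.
move: (X %/ u) (\sum_(_ <= _ < _ | _) _) (\sum_(_ <= _ < _ | ~~ _) _) => k A B.
nia.
Qed.

End TotientSum.

Section Windows.

Variables (p e u h X : nat).
Hypotheses (p_prime : prime p) (u_prime : prime u).
Hypotheses (h_gt0 : (0 < h)%N) (hu : (4 * h <= u)%N).
Hypotheses (Xp : (4 * h * X < p)%N) (XXp : (4 * h * X * X <= p)%N).
Hypothesis kernel : forall n, (0 < n <= 4 * h * X)%N -> coprime n u ->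
  (n%:R : 'F_p) ^+ e = 1.

(* Near the fraction t p / q, the integers z > t p / q satisfy
   q z = (q z - t p) mod p with q z - t p small, so z lies in the kernel
   unless u divides q z - t p; this excludes at most one of 4h consecutive z. *)
Definition windows : {set 'F_p} :=
  [set x : 'F_p | [forall j : 'I_h, ((x + j%:R) ^+ e == 1)%R]].

Local Notation start q t := (t * p %/ q)%N.
Local Notation offset q t k := (q * (start q t + k) - t * p)%N.

Lemma start_bounds q t : (0 < q)%N -> (q * start q t <= t * p < q * (start q t).+1)%N.
Proof.
move=> q_gt0; rewrite {2 3}(divn_eq (t * p) q) mulnC leq_addr /=.
by rewrite mulnS mulnC addnC ltn_add2r ltn_mod.
Qed.

Lemma offset_bounds q t k : (0 < q <= X)%N -> (0 < k <= 4 * h)%N ->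
  (0 < offset q t k <= 4 * h * X)%N.
Proof.
move=> /andP[q_gt0 qX] /andP[k_gt0 kh]; have := start_bounds t q_gt0.
have : (q * k <= X * (4 * h))%N by apply: leq_mul.
have : (q <= q * k)%N by rewrite leq_pmulr.
rewrite mulnDr mulnS; lia.
Qed.

Lemma offset_power q t k : (0 < q <= X)%N -> ~~ (u %| q)%N -> (0 < k <= 4 * h)%N ->
  ~~ (u %| offset q t k)%N -> ((start q t + k)%:R : 'F_p) ^+ e = 1.
Proof.
move=> q_bd uq k_bd uv; have v_bd := offset_bounds t q_bd k_bd.
have le_tp : (t * p <= q * (start q t + k))%N by have /andP[] := v_bd; rewrite subn_gt0 => /ltnW.
have vE : ((offset q t k)%:R : 'F_p) = q%:R * (start q t + k)%:R.
  by rewrite natrB // !natrM pchar_Fp_0 // mulr0 subr0.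
have q1 : (q%:R : 'F_p) ^+ e = 1.
  apply: kernel; last by rewrite coprime_sym prime_coprime.
  by case/andP: q_bd => -> qX; rewrite (leq_trans qX) // leq_pmull // muln_gt0.
have := kernel v_bd; rewrite coprime_sym prime_coprime // uv vE exprMn q1 mul1r.
by apply.
Qed.

(** If z follows both fractions, clearing denominators bounds (t1 q2 - t2 q1) p strictly by 4 h X
    q1, which is at most p; so t1 q2 <= t2 q1, and equality holds by symmetry. *)
Lemma start_inj q1 t1 k1 q2 t2 k2 : (0 < q1 <= X)%N -> (0 < q2 <= X)%N ->
    (0 < k1 <= 4 * h)%N -> (0 < k2 <= 4 * h)%N ->
    coprime q1 t1 -> coprime q2 t2 ->
    (start q1 t1 + k1 = start q2 t2 + k2)%N ->
  [/\ q1 = q2, t1 = t2 & k1 = k2].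
Proof.
move=> q1_bd q2_bd k1_bd k2_bd co1 co2 E.
have := offset_bounds t1 q1_bd k1_bd; have := offset_bounds t2 q2_bd k2_bd.
rewrite E; set z := (start q2 t2 + k2)%N => /andP[v2_gt0 v2_le] /andP[v1_gt0 v1_le].
have aux a1 b1 a2 b2 : (b1 <= X)%N -> (b2 <= X)%N ->
    (0 < b2)%N -> (0 < b1 * z - a1 * p)%N -> (b2 * z - a2 * p <= 4 * h * X)%N ->
    (a1 * b2 <= a2 * b1)%N.
  move=> b1X b2X b2_gt0; rewrite subn_gt0 leq_subLR => lt1 le2.
  have lt1' : (b2 * (a1 * p) < b2 * (b1 * z))%N by rewrite ltn_pmul2l.
  have le2' : (b1 * (b2 * z) <= b1 * (a2 * p + 4 * h * X))%N by rewrite leq_mul2l le2 orbT.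
  have le3 : (b1 * (4 * h * X) <= p)%N.
    by apply: leq_trans XXp; rewrite mulnC leq_mul2l b1X orbT.
  rewrite -ltnS -(ltn_pmul2r (prime_gt0 p_prime)); lia.
case/andP: q1_bd q2_bd => q1_gt0 q1X /andP[q2_gt0 q2X].
have tq : (t1 * q2 = t2 * q1)%N.
  by apply/eqP; rewrite eqn_leq !aux.
have qE : q1 = q2.
  apply/eqP; rewrite eqn_dvd -(Gauss_dvdr q2 co1) tq dvdn_mull //=.
  by rewrite -(Gauss_dvdr q1 co2) -tq dvdn_mull.
have tE : t1 = t2 by move/eqP: tq; rewrite qE eqn_pmul2r // => /eqP.
by split=> //; move: E; rewrite qE tE => /addnI.
Qed.

(** Two offsets of one fraction divisible by u would differ by q (k1 - k2) with 0 < k1 - k2 < 4h <=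
    u, so at most one is bad. It lies in at most h of the 3h + 1 windows among the 4h integers, and
    2h + 1 remain. *)
Lemma window_count :
  ((\sum_(1 <= q < X.+1 | ~~ (u %| q)) totient q) * (2 * h + 1) <= #|windows|)%N.
Proof.
pose I : finType := ('I_X.+1 * 'I_X.+1)%type; pose J := 'I_(3 * h + 1).
pose good (x : I) := [&& (0 < x.1)%N, ~~ (u %| x.1)%N, (x.2 < x.1)%N & coprime x.1 x.2].
pose G (x : I) := [set i : J | [forall j : 'I_h, ~~ (u %| offset x.1 x.2 (i + j).+1)%N]].
have G_ge x : good x -> (2 * h + 1 <= #|G x|)%N.
  case/and4P=> q_gt0 uq tq _.
  have q_bd : (0 < x.1 <= X)%N by rewrite q_gt0 -ltnS ltn_ord.
  have one_bad k1 k2 : (0 < k1 <= 4 * h)%N -> (0 < k2 <= 4 * h)%N ->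
      (u %| offset x.1 x.2 k1)%N -> (u %| offset x.1 x.2 k2)%N -> (k1 <= k2)%N.
    move=> k1_bd k2_bd u1 u2; rewrite leqNgt; apply/negP=> k21.
    have : (u %| offset x.1 x.2 k1 - offset x.1 x.2 k2)%N by rewrite dvdn_sub.
    have /andP[v2_gt0 _] := offset_bounds x.2 q_bd k2_bd.
    have -> : (offset x.1 x.2 k1 - offset x.1 x.2 k2 = x.1 * (k1 - k2))%N.
      rewrite subn_gt0 in v2_gt0; have le2 := ltnW v2_gt0.
      have le1 : (x.2 * p <= x.1 * (start x.1 x.2 + k1))%N.
        by apply: leq_trans le2 _; rewrite leq_mul2l leq_add2l ltnW ?orbT.
      by rewrite subnBA // subnK // -mulnBr subnDl.
    have {k1_bd}/andP[_ k1h] := k1_bd; have {k2_bd}/andP[k2_gt0 _] := k2_bd.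
    rewrite Euclid_dvdM // (negPf uq) /= => /dvdn_leq; rewrite subn_gt0 k21 => /(_ isT).
    rewrite leqNgt => /negP[]; apply: leq_trans hu; apply: leq_trans k1h.
    by rewrite ltn_subrL k2_gt0 (ltn_trans k2_gt0).
  have bd (i : J) (j : 'I_h) : (0 < (i + j).+1 <= 4 * h)%N.
    by have := ltn_ord i; have := ltn_ord j; lia.
  suff: (#|~: G x| <= h)%N by have := cardsC (G x); rewrite card_ord; lia.
  have [->|[i0]] := set_0Vmem (~: G x); first by rewrite cards0.
  rewrite !inE negb_forall => /existsP[j0]; rewrite negbK => bad0.
  (* The place of the bad offset inside the window starting at i; for bad windows it is below h, so
     the default of [insubd] is not reached. *)
  pose g (i : J) : 'I_h := insubd (Ordinal h_gt0) (i0 + j0 - i)%N.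
  have gE i : i \in ~: G x -> (i <= i0 + j0 < i + h)%N.
    rewrite !inE negb_forall => /existsP[j]; rewrite negbK => bad.
    have le1 := one_bad _ _ (bd i0 j0) (bd i j) bad0 bad.
    have le2 := one_bad _ _ (bd i j) (bd i0 j0) bad bad0.
    have /eqP : (i0 + j0).+1 == (i + j).+1 by rewrite eqn_leq le1 le2.
    by case=> ->; rewrite leq_addr ltn_add2l ltn_ord.
  have inj_g : {in ~: G x &, injective g}.
    move=> i1 i2 /gE/andP[le1 lt1] /gE/andP[le2 lt2] /(congr1 val).
    rewrite !val_insubd !ltn_subLR // lt1 lt2 => E; apply: val_inj => /=.
    by rewrite -(subKn le1) E subKn.
  by rewrite -(card_in_imset inj_g) (leq_trans (max_card _)) ?card_ord.
pose A := [set y : I * J | good y.1 && (y.2 \in G y.1)].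
pose f (y : I * J) : 'F_p := (start y.1.1 y.1.2 + y.2.+1)%:R.
have bd (y : I * J) (j : nat) : (j < h)%N -> (0 < (y.2 + j).+1 <= 4 * h)%N.
  by move=> jh; have := ltn_ord y.2; lia.
(* With t < q and 4hX < p the starts stay below p, so distinct integers remain distinct in
   ['F_p]. *)
have start_lt (y : I * J) : good y.1 -> (start y.1.1 y.1.2 + y.2.+1 < p)%N.
  case/and4P=> q_gt0 _ tq _; have q_bd : (0 < y.1.1 <= X)%N by rewrite q_gt0 -ltnS ltn_ord.
  have := bd y 0%N h_gt0; rewrite addn0 => k_bd.
  have /andP[_] := offset_bounds y.1.2 q_bd k_bd; rewrite leq_subLR => le_q.
  rewrite -(ltn_pmul2l q_gt0) (leq_ltn_trans le_q) //.
  apply: (@leq_trans (y.1.2.+1 * p)); first by rewrite mulSn addnC ltn_add2r.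
  by rewrite leq_mul2r tq orbT.
have f_inj : {in A &, injective f}.
  move=> y1 y2; rewrite !inE => /andP[good1 _] /andP[good2 _].
  move/(congr1 (@nat_of_ord _)); rewrite !val_Fp_nat // !modn_small ?start_lt // => E.
  case/and4P: (good1) (good2) => q1_gt0 _ _ co1 /and4P[q2_gt0 _ _ co2].
  have := bd y1 0%N h_gt0; have := bd y2 0%N h_gt0; rewrite !addn0 => k2_bd k1_bd.
  have [||e1 e2 e3] := start_inj _ _ k1_bd k2_bd co1 co2 E.
  - by rewrite q1_gt0 -ltnS ltn_ord.
  - by rewrite q2_gt0 -ltnS ltn_ord.
  move: y1 y2 e1 e2 e3 {good1 good2 E q1_gt0 co1 q2_gt0 co2 k1_bd k2_bd}.
  move=> [[q1 t1] i1] [[q2 t2] i2] /= e1 e2 [e3].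
  by congr (_, _, _); apply: val_inj.
have fA : {subset f @: A <= windows}.
  move=> _ /imsetP[y + ->]; rewrite !inE => /andP[/and4P[q_gt0 uq tq co] /forallP y_good].
  apply/forallP=> j; rewrite -natrD -addnA addSn.
  apply/eqP/offset_power => //; last exact: bd.
  by rewrite q_gt0 -ltnS ltn_ord.
rewrite (leq_trans _ (subset_leq_card (introT subsetP fA))) // card_in_imset //.
rewrite /A -sum1_card (eq_bigl (fun y => good y.1 && (y.2 \in G y.1))); last first.
  by move=> y; rewrite inE.
rewrite -(pair_big_dep good (fun x i => i \in G x) (fun _ _ => 1%N)) /=.
apply: leq_trans (_ : \sum_(x | good x) (2 * h + 1) <= _)%N; last first.
  by apply: leq_sum => x /G_ge; rewrite sum1_card.
rewrite sum_nat_const leq_mul2r; apply/orP; right.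
pose P1 (q : 'I_X.+1) := (0 < q)%N && ~~ (u %| q)%N.
pose P2 (q t : 'I_X.+1) := (t < q)%N && coprime q t.
rewrite -sum1_card (eq_bigl (fun x : I => P1 x.1 && P2 x.1 x.2)); last first.
  by move=> x; rewrite unfold_in /good /P1 /P2 -!andbA.
rewrite -(pair_big_dep P1 P2 (fun _ _ => 1%N)) /= big_add1 /= big_mkord.
rewrite [leqRHS]big_mkcond big_ord_recl /= add0n big_mkcond /=.
apply: leq_sum => q _; rewrite /P1 lift0 /=; case: ifP => // _.
have qX := ltnW (ltn_ord (lift ord0 q)).
rewrite totient_count_coprime big_mkord (big_ord_widen _ (fun d => coprime q.+1 d : nat) qX).
rewrite big_mkcond [leqRHS]big_mkcond; apply: leq_sum => t _; rewrite /P2 lift0.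
by case: ltnP => // _; case: coprime.
Qed.

End Windows.

(** The lower bound (9/40) X^2 (2h) and the upper bound h sqrt p for the number of windows are
    squared and compared; h^2 cancels. *)
Lemma kernel_bound (p l u h X : nat) : prime p -> prime l -> (l %| p.-1)%N ->
    prime u -> (0 < h <= p)%N -> (p <= 4 ^ h)%N -> (4 * h <= u)%N -> (40 <= u)%N ->
    (4 * h * X < p)%N -> (4 * h * X * X <= p)%N ->
    (forall n, (0 < n <= 4 * h * X)%N -> coprime n u ->
      (n%:R : 'F_p) ^+ (p.-1 %/ l) = 1) ->
  (81 * X ^ 4 <= 400 * p)%N.
Proof.
move=> p_prime l_prime l_dvd u_prime h_bd p_le hu u40 Xp XXp kernel.
have /andP[h_gt0 _] := h_bd.
have W2 := count_power_windows p_prime l_prime l_dvd h_bd p_le.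
have W1 := window_count p_prime u_prime h_gt0 hu Xp XXp kernel.
have D1 := sum_totient_not_dvd X u40.
move: W1 W2 D1; rewrite /windows.
move: (\sum_(_ <= _ < _ | _) _)%N #|_| => D W W1 W2 D1.
have {}W1 : (9 * X ^ 2 * (2 * h) <= 40 * W)%N by nia.
have : ((9 * X ^ 2 * (2 * h)) ^ 2 <= (40 * W) ^ 2)%N by rewrite leq_exp2r.
rewrite [leqRHS]expnMn => /leq_trans/(_ (leq_mul (leqnn _) W2)).
have -> : ((9 * X ^ 2 * (2 * h)) ^ 2 = 81 * X ^ 4 * (4 * h ^ 2))%N by lia.
have -> : (40 ^ 2 * (h ^ 2 * p) = 400 * p * (4 * h ^ 2))%N by lia.
by rewrite leq_pmul2r // muln_gt0 expn_gt0 h_gt0.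
Qed.

(** * From a Dirichlet character to l-th powers *)

Section CharacterKernel.

Variables (R : realType) (p : nat) (chi : int -> R[i]).
Hypotheses (p_prime : prime p) (chi_char : dirichlet_character p chi).
Hypothesis chi_nonprincipal : ~ principal p chi.

Lemma dirichlet1 : chi 1 = 1.
Proof.
case: chi_char => chiM _ chi0.
have chi1_neq0 : chi 1 != 0 by apply/chi0; rewrite coprimezE coprime1n.
by apply: (mulfI chi1_neq0); rewrite -chiM !mulr1.
Qed.

Lemma dirichletX (a : int) k : chi (a ^+ k) = chi a ^+ k.
Proof.
case: chi_char => chiM _ _.
by elim: k => [|k IHk]; rewrite ?expr0 ?dirichlet1 // !exprS chiM IHk.
Qed.

Lemma dirichlet_modz (a : int) : chi (a %% p)%Z = chi a.
Proof.
case: chi_char => _ chiD _.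
rewrite [in RHS](divz_eq a p) addrC; elim/int_rect: (a %/ p)%Z => [|k IHk|k IHk].
- by rewrite mul0r addr0.
- by rewrite intS mulrDl mul1r addrCA addrC chiD.
rewrite IHk -[RHS]chiD; congr chi; rewrite intS; ring.
Qed.

Lemma dirichlet_mod (n : nat) : chi (n %% p)%N = chi n.
Proof. by rewrite -[RHS]dirichlet_modz modz_nat. Qed.

Lemma dirichlet_Fp (m n : nat) : (m%:R = n%:R :> 'F_p) -> chi m = chi n.
Proof.
move/(congr1 (@nat_of_ord _)); rewrite !val_Fp_nat // => E.
by rewrite -dirichlet_mod E dirichlet_mod.
Qed.

(** On powers of a primitive root g, chi is i |-> z^i with z = chi(g), and z is not 1 as chi is
    non-principal. For l a prime factor of the order of z, chi(g^i) = 1 makes l divide i. *)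
Lemma dirichlet_kernel : exists l, [/\ prime l, (l %| p.-1)%N &
  forall n : nat, chi n = 1 -> (n%:R : 'F_p) ^+ (p.-1 %/ l) = 1].
Proof.
have [g prim_g] := Fp_primitive_root p_prime.
pose z := chi (g : nat).
have p1_gt0 := prim_order_gt0 prim_g.
have natFp (v : 'F_p) : ((v : nat)%:R : 'F_p) = v by rewrite natr_Zp.
have PoszX (m k : nat) : ((m ^ k)%N : int) = (m : int) ^+ k.
  by elim: k => // k IHk; rewrite expnS PoszM IHk exprS.
have chi_pow k (n : nat) : (n%:R : 'F_p) = g ^+ k -> chi n = z ^+ k.
  move=> nE; rewrite /z -dirichletX -PoszX; apply: dirichlet_Fp.
  by rewrite nE natrX natFp.
have z_pow : z ^+ p.-1 = 1.
  by rewrite -(chi_pow _ 1%N) ?dirichlet1 // (prim_expr_order prim_g).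
have [k prim_z k_dvd] := prim_order_exists p1_gt0 z_pow.
have log (v : 'F_p) : v != 0 -> exists i, v = g ^+ i.
  move=> v0; have [|i vE] := prim_rootP prim_g (_ : v ^+ p.-1 = 1); last by exists i.
  by apply: (mulfI v0); rewrite mulr1 -exprS prednK ?prime_gt0 // -{2}(expf_card v) card_Fp.
have Fp_neq0 (n : nat) : coprime n p -> (n%:R : 'F_p) != 0.
  move=> co; rewrite -(dvdn_pcharf (pchar_Fp p_prime)).
  by rewrite -prime_coprime // coprime_sym.
have k_gt1 : (1 < k)%N.
  have := prim_order_gt0 prim_z; case: k prim_z {k_dvd} => [|[|k]] // prim_z _.
  have z1 : z = 1 by have := prim_expr_order prim_z; rewrite expr1.
  case: chi_nonprincipal => a; have [n aE] : exists n : nat,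
      chi a = chi n /\ coprimez a p = coprime n p.
    have a_ge0 : 0 <= (a %% p)%Z by rewrite modz_ge0 // eqz_nat -lt0n prime_gt0.
    exists `|(a %% p)%Z|%N; rewrite gez0_abs // dirichlet_modz; split=> //.
    by rewrite /coprimez -gcdz_modl -/(coprimez _ _) coprimezE.
  case: aE => -> -> /Fp_neq0 /log[i nE].
  by rewrite (chi_pow i n nE) z1 expr1n.
exists (pdiv k); have l_prime := pdiv_prime k_gt1.
have l_dvd : (pdiv k %| p.-1)%N by apply: dvdn_trans (pdiv_dvd k) k_dvd.
split=> // n chi_n.
have : coprime n p.
  case: chi_char => _ _ chi0; have := chi0 n; rewrite coprimezE /= => <-.
  by rewrite chi_n oner_neq0.
case/Fp_neq0/log => i nE; move: chi_n; rewrite nE (chi_pow i n nE).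
move/eqP; rewrite -(prim_order_dvd prim_z) => /(dvdn_trans (pdiv_dvd k)) /dvdnP[j ->].
rewrite -exprM -mulnA [(pdiv k * _)%N]mulnC divnK // mulnC exprM.
by rewrite (prim_expr_order prim_g) expr1n.
Qed.

End CharacterKernel.

(** * Numerical estimates *)

Section Estimates.

Variable R : realType.

(** Use 1 - 1/x <= ln x at 4/3 and 3/2: 1/4 + 1/3 = 7/12. *)
Lemma ln2_lower : 7 / 12 <= ln 2 :> R.
Proof.
have ln_lower (x : R) : 0 < x -> 1 - x^-1 <= ln x.
  move=> x0; have xV : 0 < x^-1 by rewrite invr_gt0.
  have : ln (1 + (x^-1 - 1)) <= x^-1 - 1 by apply: le_ln1Dx; lra.
  by rewrite [X in ln X]addrC subrK lnV ?posrE //; lra.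
have -> : 2 = 4 / 3 * (3 / 2) :> R by lra.
rewrite lnM ?posrE; [|lra|lra].
have := ln_lower (4 / 3) ltac:(lra); have := ln_lower (3 / 2) ltac:(lra).
rewrite !invf_div; lra.
Qed.

Lemma constants_bounds (p0 C : R) : (p0, C) \in constants R -> 10 ^+ 7 <= p0 /\ 6 < C.
Proof.
have le10 k : (7 <= k)%N -> 10 ^+ 7 <= 10 ^+ k :> R.
  by move=> k7; apply: ler_weXn2l => //; lra.
rewrite /constants !inE.
by do !case/orP; move=> /eqP[-> ->]; (split; [exact: le10 | rewrite /decimal; lra]).
Qed.

End Estimates.

(** * Choice of the parameters and conclusion *)

Theorem theorem1p2 (R : realType) (p0 C : R) (hC : (p0, C) \in constants R)
    (p : nat) (p_prime : prime p) (p_ge : p0 <= p%:R)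
    (chi : int -> R[i]) (chi_char : dirichlet_character p chi)
    (chi_nonprincipal : ~ principal p chi)
    (u : nat) (u_prime : prime u)
    (u_ge : expR 1 ^+ 2 * ln (p%:R : R) <= u%:R) :
  exists n : nat,
    [/\ (0 < n)%N, coprime n u, chi n%:Z <> 1
      & n%:R < C * (p%:R `^ (1 / 4)) * ln (p%:R : R)].
Proof.
have [p0_ge C_gt] := constants_bounds hC.
have p_gt0 : 0 < p%:R :> R by rewrite ltr0n prime_gt0.
set s := p%:R `^ (1 / 4); set L := ln (p%:R : R) in u_ge *.
have s_gt0 : 0 < s by apply: powR_gt0.
have s4 : s ^+ 4 = p%:R.
  by rewrite -powR_mulrn ?powR_ge0 // -powRrM (_ : 1 / 4 * 4 = 1) ?powRr1 ?ltW //; lra.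
(* 56^4 = 9834496 is just below 10^7. *)
have s_ge : 56 <= s.
  rewrite leNgt; apply/negP => s56.
  have : s ^+ 4 < 56 ^+ 4 by rewrite ltr_pXn2r ?nnegrE // ltW.
  have : 56 ^+ 4 <= 10 ^+ 7 :> R by lra.
  rewrite s4; lra.
have L_le : L < 4 * s.
  by rewrite /L -s4 lnXn // -[ltLHS]mulr_natl ltr_pM2l ?ln_sublinear // ltr0n.
have L_ge : 13 <= L.
  (* 2^23 = 8388608 < 10^7, and 23 (7/12) > 13. *)
  have : ln ((2 : R) ^+ 23) <= L.
    rewrite ler_ln ?posrE ?exprn_gt0 //.
    have : 2 ^+ 23 <= 10 ^+ 7 :> R by lra.
    lra.
  rewrite lnXn // -[X in X <= _]mulr_natl; have := ln2_lower R; lra.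
(* [h] is the least integer with p <= 4^h. The factor 8/5 balances two demands: 4 (15/16) (8/5) = 6
   for the final bound, and X >= (3/2) s with 81 (3/2)^4 > 410, which contradicts 81 X^4 <= 400
   p. *)
pose h := up_log 4 p; pose X := Num.truncn (8 / 5 * s).
have p_gt1 := prime_gt1 p_prime.
have /andP[h_lower h_upper] := up_log_bounds (isT : 1 < 4)%N p_gt1.
have h_gt0 : (0 < h)%N by rewrite up_log_gt0.
(* h - 1 < L / (2 ln 2) <= (6/7) L and 1 <= L/13, with 6/7 + 1/13 < 15/16. *)
have h_le : h%:R <= 15 / 16 * L.
  have : ln ((4 : R) ^+ h.-1) <= L.
    by rewrite ler_ln ?posrE ?exprn_gt0 // -natrX ler_nat ltnW.
  have -> : (4 : R) = 2 * 2 by lra.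
  rewrite lnXn ?mulr_gt0 // lnM ?posrE // -[X in X <= _]mulr_natl.
  have -> : h%:R = h.-1%:R + 1 :> R by rewrite natr1 prednK.
  have := ln2_lower R; have : 0 <= h.-1%:R :> R by [].
  rewrite -/L; set k : R := h.-1%:R; set l2 := ln 2 => k0 l2_ge kL.
  have : k * (7 / 6) <= k * (l2 + l2) by rewrite ler_wpM2l //; lra.
  lra.
have [X_le X_gt] : X%:R <= 8 / 5 * s /\ 3 / 2 * s <= X%:R.
  have : 0 <= 8 / 5 * s by lra.
  move/truncn_itv => /andP[]; rewrite -/X -natr1 => ? ?; split; lra.
have hX_le : (4 * h * X)%:R <= 6 * (s * L).
  rewrite !natrM.
  apply: le_trans (_ : 4 * (15 / 16 * L) * (8 / 5 * s) <= _); last by lra.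
  by rewrite ler_pM ?mulr_ge0 ?ler0n // ler_pM2l.
have L_gt0 : 0 < L by lra.
have X_gt0 : (0 < X)%N by rewrite -(ltr_nat R); lra.
(* With log p < 4 s, 4 h X^2 is at most 6 s (4 s) (8/5) s = (192/5) s^3, below 40 s^3 and so below
   s^4. *)
have p_cube : 40 * s ^+ 3 < p%:R.
  rewrite -s4 [s ^+ 4]exprS ltr_pM2r ?exprn_gt0 //; lra.
have XXp : (4 * h * X * X < p)%N.
  rewrite -(ltr_nat R) natrM; apply: le_lt_trans p_cube.
  apply: le_trans (_ : 6 * (s * (4 * s)) * (8 / 5 * s) <= _).
    apply: ler_pM => //; apply: le_trans hX_le _.
    by rewrite !ler_pM2l // ltW.
  have : 0 <= s ^+ 3 by rewrite exprn_ge0 // ltW.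
  have -> : 6 * (s * (4 * s)) * (8 / 5 * s) = 192 / 5 * s ^+ 3 by field.
  lra.
have Xp : (4 * h * X < p)%N by apply: leq_ltn_trans XXp; rewrite leq_pmulr.
(* From e >= 2 comes u >= 4 log p, which dominates both 4h and 40. *)
have e_ge : 2 <= expR 1 :> R by have := @expR_ge1Dx R 1; lra.
have u_ge4 : 4 * L <= u%:R.
  apply: le_trans u_ge; rewrite ler_wpM2r ?(ltW L_gt0) //.
  by rewrite expr2; nra.
have hu : (4 * h <= u)%N by rewrite -(ler_nat R) natrM; lra.
have u40 : (40 <= u)%N by rewrite -(ler_nat R); lra.
have hp : (0 < h <= p)%N.
  by rewrite h_gt0 /=; apply: leq_trans (ltnW Xp); rewrite -mulnA mulnCA leq_pmulr ?muln_gt0.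
have [l [l_prime l_dvd kernel]] := dirichlet_kernel p_prime chi_char chi_nonprincipal.
have [/existsP[n /and3P[n_gt0 co_n chi_n]]|none] :=
  boolP [exists n : 'I_(4 * h * X).+1, [&& (0 < n)%N, coprime n u & chi n%:Z != 1]].
  exists n; split=> //; first exact/eqP.
  apply: (@le_lt_trans _ _ (4 * h * X)%:R); first by rewrite ler_nat -ltnS.
  apply: le_lt_trans hX_le _; rewrite -mulrA ltr_pM2r // mulr_gt0 //.
have : (81 * X ^ 4 <= 400 * p)%N.
  apply: (kernel_bound p_prime l_prime l_dvd u_prime hp h_upper hu u40 Xp (ltnW XXp)).
  move=> n n_bd co_n.
  apply: kernel; apply/eqP; apply: contraR none => chi_n; apply/existsP.
  have n_lt : (n < (4 * h * X).+1)%N by case/andP: n_bd.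
  by exists (Ordinal n_lt); rewrite /= co_n chi_n; case/andP: n_bd => ->.
rewrite leqNgt => /negP[]; rewrite -(ltr_nat R) 2!natrM natrX -s4.
apply: lt_le_trans (_ : 81 * (3 / 2 * s) ^+ 4 <= _).
  rewrite exprMn; have : 0 < s ^+ 4 by rewrite exprn_gt0.
  lra.
by rewrite ler_pM2l // lerXn2r ?nnegrE ?ler0n //; lra.
Qed.
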